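(* Let $n\ge1$ and let $\lambda$ be a partition of $n$. The following formulas hold, for all integer parameters such that the upper index of $X$ is a partition of $n$ (with $k\ge1$ in (2), $h_2\ge1$ in (4)). (1) $$X^{(n-k,k)}_\lambda(t)=\sum_{\substack{\tau\lhd\lambda,\ |\tau|\le k\\ \rho\vdash (k-|\tau|)}}\frac{(-1)^{l(\rho)}}{z_\rho(t)}.$$ (2) For every partition $\mu$ of $n$, $$X^{(k,1^{n-k})}_\mu(t)=\frac{\prod_{i=1}^{n-k}(t^i-1)}{\prod_{j\ge1}(t^{\mu_j}-1)}\sum_{\substack{\tau\lhd\mu\\ |\tau|\ge k}}\ \prod_{j\ge1}(t^{\tau_j}-1).$$ (3) $$X^{(k_1,k_2,k_3)}_\lambda(t)=\sum_{\substack{\tau\lhd\lambda,\ |\tau|\le k_2+k_3\\ \rho\vdash(k_2+k_3-|\tau|)}}\ \sum_{\substack{\nu\lhd(\tau\cup\rho),\ |\nu|\le k_3\\ \xi\vdash(k_3-|\nu|)}}\frac{(-1)^{l(\xi)+l(\rho)}}{z_\xi(t)\,z_\rho(t)}.$$ (4) $$X^{(h_1,h_2,1^{n-h_1-h_2})}_\lambda(t)=\sum_{\substack{\tau\lhd\lambda,\ |\tau|\le n-h_1\\ \rho\vdash(n-h_1-|\tau|)}}\ \sum_{\substack{\mu\lhd(\tau\cup\rho)\\ h_2\le|\mu|\le n-h_1}}\frac{\prod_{i=1}^{n-h_1-h_2}(t^i-1)\ \prod_{l\ge1}(t^{\mu_l}-1)}{z_\rho\ \prod_{j\ge1}(t^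{\tau_j}-1)}.$$
   Context: Let $V$ be the ring of symmetric functions over $\mathbb Q(t)$, with power sums $p_n$, $p_\lambda=p_{\lambda_1}p_{\lambda_2}\cdots$. For a partition $\lambda$ with $m_i(\lambda)$ parts equal to $i$, put $z_\lambda=\prod_{i\ge1}i^{m_i(\lambda)}m_i(\lambda)!$ and $z_\lambda(t)=z_\lambda/\prod_{i=1}^{l(\lambda)}(1-t^{\lambda_i})$; $l(\lambda)$ is the number of nonzero parts and $|\lambda|$ the weight. Equip $V$ with the bilinear form $\langle p_\lambda,p_\mu\rangle=\delta_{\lambda\mu}z_\lambda(t)$. Define $q_n\in V$ by $\sum_{n\ge0}q_nz^n=\exp\left(\sum_{n\ge1}\frac{1-t^n}{n}p_nz^n\right)$. The Hall-Littlewood functions are $Q_\lambda(t)=\prod_{i<j}\frac{1-R_{ij}}{1-tR_{ij}}\,q_{\lambda_1}\cdots q_{\lambda_l}$, where the raising operator $R_{ij}$ raises the $i$-th index by 1 and lowers the $j$-th index by 1, and $P_\lambda(t)=b_\lambda(t)^{-1}Q_\lambda(t)$ with $b_\lambda(t)=\prod_{i\ge1}\prod_{j=1}^{m_i(\lambda)}(1-t^j)$; one has $\langle P_\lambda,Q_\mu\rangle=\delta_{\lambda\mu}$. The Green polynomials $X^\lambda_\mu(t)$ are defined by $p_\mu=\sum_\lambda X^\lambda_\mu(t)P_\lambda(t)$; equivalently $X^\lambda_\mu(t)=\langle Q_\lambda(t),p_\mu\rangle$. A subpartition $\tau\lhd\mu$ of $\mu=(\mu_1,\ldots,\mu_l)$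 is $\tau=(\mu_{i_1},\ldots,\mu_{i_s})$ for some $1\le i_1<\cdots<i_s\le l$ (possibly $\emptyset$ or $\mu$). Sums over $\tau\lhd\mu$ run over the $2^{l(\mu)}$ index subsets, i.e. subpartitions are counted with multiplicity. $\tau\cup\rho$ is the partition whose parts are all the parts of $\tau$ and $\rho$ together. Products such as $\prod_{j\ge1}(t^{\tau_j}-1)$ are over the nonzero parts only, and empty products equal 1. *)

(* Defs.v *)
From HB Require Import structures.
From mathcomp Require Import all_boot all_order all_algebra.
From mathcomp Require Import finmap.
From mathcomp.multinomials Require Import monalg.

Set Implicit Arguments.
Unset Strict Implicit.
Unset Printing Implicit Defensive.

Import GRing.Theory.
Local Open Scope ring_scope.

(* A partition is the weakly decreasing sequence of its nonzero parts. *)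
Definition is_partition (s : seq nat) : bool := sorted geq s && (0 \notin s)%N.

Definition is_partition_of (n : nat) (s : seq nat) : bool :=
  is_partition s && (sumn s == n).

(* A partition of n has at most n parts, all of them at most n. *)
Definition partitions (n : nat) : seq (seq nat) :=
  [seq s <- [seq map val (b : seq 'I_n.+1) | b : n.-bseq 'I_n.+1]
     | is_partition_of n s].

Lemma partitions_uniq n : uniq (partitions n).
Proof.
apply/filter_uniq; rewrite map_inj_uniq ?enum_uniq // => b c /=.
by move/(inj_map val_inj) => e; apply: val_inj.
Qed.

Lemma mem_partitions n s : (s \in partitions n) = is_partition_of n s.
Proof.
rewrite mem_filter andbC; case Ps: (is_partition_of n s); last by rewrite andbF.
rewrite andbT; move: Ps => /andP[/andP[_ s0] /eqP sn].
have ssize : (size s <= n)%N.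
  rewrite -sn; elim: s s0 {sn} => //= x s IH.
  rewrite inE negb_or eq_sym -lt0n => /andP[x0 /IH h].
  by rewrite -add1n leq_add.
have sle x : x \in s -> (x < n.+1)%N.
  rewrite ltnS -sn; elim: s {s0 sn ssize} => //= y s IH.
  rewrite inE => /orP[/eqP->|/IH h]; first exact: leq_addr.
  exact: leq_trans h (leq_addl _ _).
have bP : (size (map (@inord n) s) <= n)%N by rewrite size_map.
apply/mapP; exists (Bseq bP); first by rewrite mem_enum.
rewrite /= -map_comp -[LHS]map_id; apply/eq_in_map => x xs /=.
by rewrite inordK // sle.
Qed.

(* Subpartitions, one for each of the 2 ^ l(mu) sets of indices. *)
Definition subpartitions (mu : seq nat) : seq (seq nat) :=
  [seq mask (b : seq bool) mu | b : (size mu).-tuple bool].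

Definition cup_partition (tau rho : seq nat) : seq nat := sort geq (tau ++ rho).

Definition drop_zeros (s : seq nat) : seq nat := [seq i <- s | (0 < i)%N].

Section SymmetricFunctions.
Variables (K : fieldType) (t : K).

(* z_lambda ; the bound sumn lam on i is harmless since no part exceeds it. *)
Definition zpart (lam : seq nat) : K :=
  (\prod_(1 <= i < (sumn lam).+1)
      (i ^ count_mem i lam * (count_mem i lam)`!)%N)%:R.

Definition zpart_t (lam : seq nat) : K :=
  zpart lam / \prod_(i <- lam) (1 - t ^+ i).

Definition bpart (lam : seq nat) : K :=
  \prod_(1 <= i < (sumn lam).+1)
    \prod_(1 <= j < (count_mem i lam).+1) (1 - t ^+ j).

(* In characteristic 0 the ring of symmetric functions over K is the free
   commutative algebra on the power sums p_1, p_2, ... . The generator with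
   index i stands for p_(i.+1). *)
Local Notation symfun := {malg K[{cmonom nat}]}.

(* Meaningful for n >= 1 only. *)
Definition psum (n : nat) : symfun := << ucm n.-1 >>.

Definition psum_part (lam : seq nat) : symfun := \prod_(i <- lam) psum i.

(* The series sum_(n >= 1) (1 - t^n) / n p_n z^n up to degree N. *)
Definition qexponent (N : nat) : {poly symfun} :=
  \sum_(1 <= n < N.+1) ((1 - t ^+ n) / n%:R *: psum n) *: 'X^n.

(* Coefficient of z^n in the exponential: since the exponent has no constant
   term, its truncation at degree n and the first n+1 terms of the exponential
   series suffice. *)
Definition qfun (n : nat) : symfun :=
  \sum_(j < n.+1) (j`!%:R^-1 : K) *: (qexponent n ^+ j)`_n.

Definition qint (a : int) : symfun := if a is Posz n then qfun n else 0.

(* Coefficient of R^a in (1 - R) / (1 - t R) = (1 - R) * sum_a t^a R^a. *)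
Definition raising_coef (a : nat) : K :=
  t ^+ a - (if (0 < a)%N then t ^+ a.-1 else 0).

(* The product over i < j of (1 - R_ij) / (1 - t R_ij), expanded: a (i, j) is
   the exponent of R_ij. If some a (i, j) exceeds |lam|, the sum of the shifted
   indices in positions >= j is negative, so one of them is negative and the
   term vanishes; hence exponents up to |lam| suffice. *)
Definition HLQ (lam : seq nat) : symfun :=
  \sum_(a : {ffun 'I_(size lam) * 'I_(size lam) -> 'I_(sumn lam).+1}
        | [forall ij : 'I_(size lam) * 'I_(size lam),
             (ij.2 <= ij.1)%N ==> (a ij == ord0)])
    (\prod_(ij : 'I_(size lam) * 'I_(size lam) | (ij.1 < ij.2)%N)
        raising_coef (a ij)) *:
    \prod_(i < size lam)
      qint ((nth 0%N lam i)%:Z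
            + \sum_(j < size lam | (i < j)%N) (a (i, j) : nat)%:Z
            - \sum_(j < size lam | (j < i)%N) (a (j, i) : nat)%:Z).

Definition HLP (lam : seq nat) : symfun := (bpart lam)^-1 *: HLQ lam.

(* X lam mu = X^lam_mu(t). By homogeneity only partitions lam of |mu| occur;
   the P_lam form a basis of the symmetric functions, so such an X exists and
   is unique on pairs of partitions of the same weight. *)
Definition green_polynomials (X : seq nat -> seq nat -> K) : Prop :=
  forall mu, is_partition mu ->
    psum_part mu = \sum_(lam <- partitions (sumn mu)) X lam mu *: HLP lam.

End SymmetricFunctions.

Definition Qt : fieldType := {fraction {poly rat}}.
Definition t : Qt := FracField.tofrac ('X : {poly rat}).

(* Main.v *)
Require Import Defs.
From HB Require Import structures.
From mathcomp Require Import all_boot all_order all_algebra.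
From mathcomp Require Import finmap ring zify.
From mathcomp.multinomials Require Import monalg.

Set Implicit Arguments.
Unset Strict Implicit.
Unset Printing Implicit Defensive.

Import Order.TTheory GRing.Theory Num.Theory.
Local Open Scope ring_scope.

(** Write q(z) for the generating series of the q_n and g(z) for its inverse.
    Adding a letter w to the alphabet, p_n -> p_n + w^n, and removing a letter,
    p_n -> p_n - w^n, are ring morphisms to the polynomials in w, and they
    multiply q(z) by the factors (1 - t w z) / (1 - w z) and
    (1 - w z) / (1 - t w z) ([coef_sigma_q], [coef_tau_q]).  The second factor is
    the raising factor (1 - R) / (1 - t R), so expanding the row of raising
    operators that involve the first index shows that Q_(m, lam) is obtained from
    Q_lam by the vertex operator [creation m], the coefficient of z^m in
    q(z) f(p_n - z^(-n)) ([HL_raisingE]).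

    The operator adjoint to [creation n] for the form <p_lam, p_mu> is
    [annihilation n], the coefficient of w^n in g(1/w) f(p_n + w^n).  Hence
    <Q_lam, f> is the constant term of what remains of f when the operators
    [annihilation lam_1], [annihilation lam_2], and so on are applied in turn;
    this functional is [green_form lam].  Orthogonality of the Hall-Littlewood
    functions says that it takes the value b_lam at Q_lam and vanishes at the other
    Q_mu ([green_form_HLfun]), which follows by comparing the first parts.  If lam_1 >= mu_1, adding a letter to Q_mu gives a polynomial in that
    letter of degree at most mu_1, whose coefficient of degree mu_1 is
    1 - t^m times Q_mu with its first part deleted, where m is the multiplicity of
    that part ([sigma_HLfun_small], [sigma_HLfun_head]).  If lam_1 < mu_1, then
    [green_form lam] vanishes on all multiples of q_k for k > lam_1, hence on the
    image of [creation mu_1] ([kills_above_annihilation]).  Consequently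
    X^lam_mu is [green_form lam] applied to p_mu ([green_polynomialE]).

    The four formulas are then computations with [annihilation].  In the product
    of the p_i + w^i over the parts of a partition each factor contributes either
    p_i or w^i, which produces the subpartitions tau, and
    g_n is the sum of (-1)^l(rho) p_rho / z_rho(t) over the partitions rho of n
    ([gE], an instance of [newton_partition_sum]); so every row removed from the
    upper index costs one sum over tau and one over rho ([green_form_cons]).
    A single row has value 1, which gives the formulas for two and three rows.
    When the row is removed from a hook, the denominators 1 - t^i in the value at
    the remaining column cancel against z_rho(t), the sum over rho becomes the sum
    of 1 / z_rho, which is 1 ([sum_inv_zpart]), and passing to complementary
    subpartitions gives the hook formula; columns are themselves hooks.  Removing a
    row above a hook gives the last formula. *)

(** * Newton's recursion *)

Section Convolution.
Variable R : comNzRingType.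
Implicit Types (a b e f g u v : nat -> R).

Definition conv u v n : R := \sum_(i < n.+1) u i * v (n - i)%N.

(** In characteristic 0 and when a_0 = 0, this says that the series of e is the
    exponential of the sum of a_n z^n / n. *)
Definition newton a e := e 0%N = 1 /\ forall n, e n *+ n = conv a e n.

Lemma conv_poly u v n m : (n < m)%N ->
  conv u v n = ((\poly_(i < m) u i) * (\poly_(i < m) v i))`_n.
Proof.
move=> nm; rewrite coefM; apply: eq_bigr => i _; rewrite !coef_poly.
rewrite (leq_ltn_trans (leq_subr _ _) nm) (leq_trans (ltn_ord i)) //.
Qed.

Lemma eq_conv u u' v v' n : (forall i, (i <= n)%N -> u i = u' i) ->
  (forall i, (i <= n)%N -> v i = v' i) -> conv u v n = conv u' v' n.
Proof.
move=> eu ev; apply: eq_bigr => i _.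
by rewrite eu ?ev ?leq_subr // -ltnS.
Qed.

Lemma convC u v n : conv u v n = conv v u n.
Proof. by rewrite !(@conv_poly _ _ _ n.+1) // mulrC. Qed.

(** Truncated generating polynomials turn convolution into a product, which
    is associative. *)
Lemma convA u v w n : conv u (conv v w) n = conv (conv u v) w n.
Proof.
have h x y i : (i <= n)%N -> conv x y i =
    ((\poly_(j < n.+1) x j) * (\poly_(j < n.+1) y j))`_i.
  by move=> le_in; apply: conv_poly.
transitivity (((\poly_(j < n.+1) u j) *
   ((\poly_(j < n.+1) v j) * (\poly_(j < n.+1) w j)))`_n).
  rewrite coefM; apply: eq_bigr => i _.
  by rewrite coef_poly ltn_ord -h ?leq_subr.
rewrite mulrA coefMr convC; apply: eq_bigr => i _.
rewrite coef_poly ltn_ord h ?leq_subr // mulrC //.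
Qed.

Lemma convDl u v w n : conv (fun i => u i + v i) w n = conv u w n + conv v w n.
Proof. by rewrite -big_split; apply: eq_bigr => i _; rewrite mulrDl. Qed.

(** Exponentials multiply when exponents add: the left side of the recursion is
    a derivation for convolution. *)
Lemma newton_conv a b e f : newton a e -> newton b f ->
  newton (fun i => a i + b i) (conv e f).
Proof.
move=> [e0 ne] [f0 nf]; split=> [|n]; first by rewrite /conv big_ord1 e0 f0 mul1r.
transitivity (conv (fun i => e i *+ i) f n + conv e (fun i => f i *+ i) n).
  rewrite -big_split -sumrMnl; apply: eq_bigr => i _ /=.
  by rewrite -[X in _ *+ X = _](subnKC (leq_ord i)) mulrnDr mulrnAl mulrnAr.
rewrite convDl convA (@eq_conv (conv a e) (fun i => e i *+ i) f f) //.
congr (_ + _); rewrite convA (@eq_conv (conv b e) (conv e b) f f) //; last first.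
  by move=> i _; rewrite convC.
by rewrite -convA; apply: eq_conv => // i _; rewrite -nf.
Qed.

Lemma newton_uniq a e f : (forall n (x : R), x *+ n.+1 = 0 -> x = 0) ->
  a 0%N = 0 -> newton a e -> newton a f -> e =1 f.
Proof.
move=> tf a0 [e0 ne] [f0 nf] n; elim/ltn_ind: n => -[|n] IH; first by rewrite e0.
apply/eqP; rewrite -subr_eq0; apply/eqP/(tf n); rewrite mulrnBl ne nf.
apply/eqP; rewrite subr_eq0 /conv !(big_ord_recl n.+1) a0 !mul0r; apply/eqP.
by congr (_ + _); apply: eq_bigr => i _; rewrite IH // subSS ltnS leq_subr.
Qed.

Lemma eq_newton a b e : a =1 b -> newton a e -> newton b e.
Proof.
by move=> ab [e0 ne]; split=> // n; rewrite ne; apply: eq_conv => // i _.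
Qed.

Lemma newton0 : newton (fun=> 0) (fun n => (n == 0%N)%:R).
Proof.
split=> // n; rewrite /conv big1 => [|i _]; last by rewrite mul0r.
by case: n => // n; rewrite mul0rn.
Qed.

Lemma newton_inverse a e f : (forall n (x : R), x *+ n.+1 = 0 -> x = 0) ->
  a 0%N = 0 -> newton a e -> newton (fun i => - a i) f ->
  forall n, conv e f n = (n == 0%N)%:R.
Proof.
move=> tf a0 ne nf.
apply: (@newton_uniq (fun i => a i - a i) (conv e f) (fun n => (n == 0%N)%:R)) => //.
- by rewrite subrr.
- exact: newton_conv.
have [d0 nd] := newton0.
split=> // m; rewrite nd; apply: eq_conv => // i _; by rewrite subrr.
Qed.

Lemma newton_scale a e (x : R) : newton a e ->
  newton (fun i => a i * x ^+ i) (fun i => e i * x ^+ i).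
Proof.
move=> [e0 ne]; split=> [|n]; first by rewrite e0 mulr1.
rewrite -mulrnAl ne mulr_suml; apply: eq_bigr => i _.
by rewrite -[X in _ * x ^+ X = _](subnKC (leq_ord i)) exprD mulrACA.
Qed.

End Convolution.

Lemma newton_morph (R R' : comNzRingType) (h : {rmorphism R -> R'}) a e :
  newton a e -> newton (h \o a) (h \o e).
Proof.
move=> [e0 ne]; split=> [|n] /=; first by rewrite e0 rmorph1.
by rewrite -rmorphMn ne rmorph_sum; apply: eq_bigr => i _; rewrite rmorphM.
Qed.

Section FactorSeries.
Variables (K : comNzRingType) (t : K).

(** The coefficients of (1 - t z) / (1 - z). *)
Definition scattering_coef n : K := t *+ (n == 0%N) + (1 - t).

Lemma newton_scattering :
  newton (fun i => 1 - t ^+ i) scattering_coef.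
Proof.
split=> [|n]; first by rewrite /scattering_coef mulr1n addrC subrK.
have -> : conv (fun i => 1 - t ^+ i) scattering_coef n =
   (1 - t ^+ n) * t + (\sum_(i < n.+1) (1 - t ^+ i)) * (1 - t).
  rewrite mulr_suml /conv big_ord_recr /= subnn [in RHS]big_ord_recr /=.
  rewrite {2}/scattering_coef mulr1n mulrDr addrC -addrA; congr (_ + _).
  rewrite addrC; congr (_ + _); apply: eq_bigr => i _.
  by rewrite /scattering_coef subn_eq0 leqNgt ltn_ord /= add0r.
have -> : (\sum_(i < n.+1) (1 - t ^+ i)) * (1 - t) =
   (1 - t) *+ n.+1 - (1 - t ^+ n.+1).
  rewrite sumrB sumr_const card_ord mulrBl mulrnAl mul1r; congr (_ - _).
  by rewrite -[1 - t ^+ _]opprB subrX1 -mulNr opprB mulrC.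
rewrite /scattering_coef; case: n => [|n] /=.
  by rewrite mulr0n expr0 subrr mul0r add0r mulr1n expr1 subrr.
by rewrite mulr0n add0r [_ *+ n.+2]mulrSr [t ^+ n.+2]exprS; ring.
Qed.

End FactorSeries.

(** * Substitution for the power sums *)

Section Substitution.
Variables (K : fieldType) (R : comNzRingType).
Local Notation symfun := {malg K[{cmonom nat}]}.

(** The generator with index i stands for the power sum of degree i + 1, hence
    the shift in the valuation. *)
Definition monomial_value (v : nat -> R) (m : {cmonom nat}) : R :=
  \prod_(i <- finsupp m) v i.+1 ^+ m i.

Lemma monomial_value_sub v (m : {cmonom nat}) (D : {fset nat}) :
  (finsupp m `<=` D)%fset -> monomial_value v m = \prod_(i <- D) v i.+1 ^+ m i.
Proof.
move=> le; rewrite /monomial_value (big_fset_incl _ le) // => i _.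
by rewrite -cmE_eq0 => /eqP ->.
Qed.

Lemma monomial_value_morph v : mmorphism (monomial_value v).
Proof.
split=> [m1 m2|]; last by rewrite /monomial_value mdom1 big_seq_fset0.
rewrite (@monomial_value_sub v m1 (finsupp m1 `|` finsupp m2)%fset) ?fsubsetUl //.
rewrite (@monomial_value_sub v m2 (finsupp m1 `|` finsupp m2)%fset) ?fsubsetUr //.
rewrite /monomial_value mdomD -big_split; apply: eq_bigr => i _.
by rewrite cmM exprD.
Qed.

HB.instance Definition _ v :=
  isMultiplicative.Build {cmonom nat} R (monomial_value v) (monomial_value_morph v).

Definition subst_psum (c : {rmorphism K -> R}) (v : nat -> R) : {rmorphism symfun -> R} :=
  mmap c (monomial_value v).

Lemma subst_psumE c v n : subst_psum c v (psum K n.+1) = v n.+1.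
Proof.
by rewrite /= mmapU /= rmorph1 mul1r /monomial_value mdomU big_seq_fset1 cmUU expr1.
Qed.

Lemma subst_psumZ c v a f : subst_psum c v (a *: f) = c a * subst_psum c v f.
Proof. by rewrite /= mmapZ. Qed.

End Substitution.

Section SymmetricFunctions.
Variables (K : fieldType).
Local Notation symfun := {malg K[{cmonom nat}]}.
Local Notation p := (psum K).
Implicit Types f g : symfun.

Lemma monalgU_scale c (m : {cmonom nat}) : << c *g m >> = c *: << m >> :> symfun.
Proof.
by rewrite -mul_malgC malgM_def fgmulUU mulr1 mul1m.
Qed.

Lemma symfun_ind (P : symfun -> Prop) :
  P 1 -> (forall f g, P f -> P g -> P (f + g)) ->
  (forall c f, P f -> P (c *: f)) ->
  (forall n f, P f -> P (p n.+1 * f)) -> forall f, P f.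
Proof.
move=> P1 PD PZ PM f.
have PU (m : {cmonom nat}) : P << m >>.
  have [d le_md] : exists d, (mdeg m < d)%N by exists (mdeg m).+1.
  elim: d m le_md => [|d IH] m.
    rewrite ltn0; discriminate.
  move=> le_md.
  have [/eqP->|] := boolP (m == mone); first exact: P1.
  move=> m1; have /fset0Pn [i0 im] : finsupp m != fset0.
    apply: contraNneq m1 => m0.
    by rewrite -mdeg_eq0 mdegE m0 big_seq_fset0.
  have mi : m = mul (ucm i0) (divcm m (ucm i0)).
    apply/eqP/cmP => j; rewrite cmM cmU divcmE ucmE.
    have [<-|_] := eqVneq i0 j; last by rewrite add0n subn0.
    rewrite subnKC // lt0n cmE_neq0; exact: im.
  have e : << m >> = p i0.+1 * << divcm m (ucm i0) >> :> symfun.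
    by rewrite malgM_def fgmulUU mulr1 {1}mi.
  refine (eq_ind_r P _ e).
  apply: PM; apply: IH; rewrite ltnS in le_md.
  by rewrite (leq_trans _ le_md) // [in X in (_ < X)%N]mi mdegM mdegU.
rewrite (monalgE f); elim/big_ind: _ => [|//|m _].
  by rewrite -(scale0r 1); apply: PZ.
have e : << f@_m *g m >> = f@_m *: << m >> :> symfun.
  exact: monalgU_scale.
refine (eq_ind_r P _ e).
exact: PZ (PU m).
Qed.

End SymmetricFunctions.

(** * Exponentials of power series *)

Section Exponential.
Variables (K : fieldType) (S : comAlgType K).
Hypothesis charK : forall n, n.+1%:R != 0 :> K.

Lemma torsionfree n (f : S) : f *+ n.+1 = 0 -> f = 0.
Proof.
move=> h; have : (n.+1%:R : K)^-1 *: (f *+ n.+1) = 0 by rewrite h scaler0.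
by rewrite -scaler_nat scalerA mulVf // scale1r.
Qed.

Lemma poly_torsionfree n (P : {poly S}) : P *+ n.+1 = 0 -> P = 0.
Proof.
move=> h; apply/polyP => i; rewrite coef0; apply: (@torsionfree n).
by rewrite -coefMn h coef0.
Qed.

Variable b : nat -> S.

Definition exponent N : {poly S} := \sum_(1 <= n < N.+1) b n *: 'X^n.

Definition exp_coef n : S :=
  \sum_(j < n.+1) (j`!%:R^-1 : K) *: (exponent n ^+ j)`_n.

Lemma coef_exponent N i :
  (exponent N)`_i = if (0 < i <= N)%N then b i else 0.
Proof.
rewrite coef_sum (eq_bigr (fun n => if n == i then b n else 0)) => [|n _]; last first.
  by rewrite coefZ coefXn eq_sym; case: eqP => _; rewrite ?mulr1 ?mulr0.
by rewrite -big_mkcond /= big_nat1_eq ltnS.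
Qed.

(** The exponent has no constant term, so its j-th power starts in degree j. *)
Lemma coef_exponent_exp_small N j i : (i < j)%N -> (exponent N ^+ j)`_i = 0.
Proof.
elim: j i => // j IH i ij; rewrite exprS coefM big1 // => k _.
have [->|k0] := posnP (val k); first by rewrite coef_exponent mul0r.
have ki : (k <= i)%N by rewrite -ltnS.
by rewrite IH ?mulr0 // ltn_subLR // (leq_trans ij) // -add1n leq_add2r.
Qed.

Lemma coef_exponent_exp_stable N M j i : (i <= N)%N -> (i <= M)%N ->
  (exponent N ^+ j)`_i = (exponent M ^+ j)`_i.
Proof.
elim: j i => [|j IH] i iN iM; first by rewrite !expr0.
rewrite !exprS !coefM; apply: eq_bigr => k _.
have ki : (k <= i)%N by rewrite -ltnS.
rewrite !coef_exponent (leq_trans ki iN) (leq_trans ki iM); congr (_ * _).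
by apply: IH; apply: leq_trans (leq_subr _ _) _.
Qed.

(** The exponential series cut off after its term of index M, applied to the
    exponent cut off at degree N: a polynomial, so that it can be differentiated. *)
Definition exp_series M N : {poly S} :=
  \sum_(j < M.+1) ((j`!%:R^-1 : K)%:A)%:P * exponent N ^+ j.

Lemma coef_exp_series M N n : (n <= M)%N -> (n <= N)%N ->
  (exp_series M N)`_n = exp_coef n.
Proof.
move=> nM nN; rewrite coef_sum /exp_coef.
rewrite (big_ord_widen M.+1
  (fun j => (j`!%:R^-1 : K) *: (exponent n ^+ j)`_n)) // [RHS]big_mkcond /=.
apply: eq_bigr => j _; rewrite coefCM mulr_algl.
rewrite (coef_exponent_exp_stable (M := n)) //.
by rewrite ltnS; case: leqP => // nj; rewrite coef_exponent_exp_small ?scaler0.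
Qed.

Lemma deriv_exp_series N :
  (exp_series N.+1 N.+1)^`() = (exponent N.+1)^`() * exp_series N N.+1.
Proof.
rewrite /exp_series raddf_sum big_ord_recl /= expr0 mulr1 derivC add0r mulr_sumr.
apply: eq_bigr => j _; rewrite deriv_mulC deriv_exp /= -mulrnAr mulrCA.
congr (_ * _); rewrite mulrnAr -mulrnAl; congr (_ * _).
rewrite -polyCMn scalerMnl; congr (_ *: 1)%:P.
by rewrite factS natrM invfM -mulr_natr mulrAC mulVf ?mul1r.
Qed.

(** Compare coefficients in the differential equation E' = A' E of the
    exponential E of a series A. *)
Lemma newton_exp_coef : newton (fun n => b n *+ n) exp_coef.
Proof.
split=> [|n].
  by rewrite /exp_coef big_ord1 fact0 invr1 scale1r expr0 coef1.
case: n => [|n].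
  by rewrite mulr0n /conv big_ord1 mulr0n mul0r.
rewrite -(@coef_exp_series n.+1 n.+1) // -coef_deriv deriv_exp_series coefM.
rewrite /conv [RHS]big_ord_recl /= mulr0n mul0r add0r; apply: eq_bigr => i _.
have le_in : (i < n.+1)%N by [].
by rewrite coef_deriv coef_exponent /= le_in subSS coef_exp_series ?leq_subr // leqW ?leq_subr.
Qed.

End Exponential.

(** * Sums over partitions *)

(** Both z_lam and b_lam are products over i of a function of i and of its
    multiplicity; adding one part changes a single factor. *)
Lemma prod_multiplicities_cons (R : comNzRingType) (f : nat -> nat -> R) h n s :
  (forall i, f i 0%N = 1) -> (0 < n)%N ->
  f n (count_mem n s).+1 = h * f n (count_mem n s) ->
  \prod_(1 <= i < (sumn (n :: s)).+1) f i (count_mem i (n :: s)) =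
  h * \prod_(1 <= i < (sumn s).+1) f i (count_mem i s).
Proof.
move=> f0 n0 fS.
have count0 i : (sumn s < i)%N -> count_mem i s = 0%N.
  move=> si; apply/count_memPn; apply: contraL si => si.
  by rewrite -leqNgt (perm_sumn (perm_to_rem si)) leq_addr.
rewrite [in RHS](big_nat_widen _ _ (sumn (n :: s)).+1) ?ltnS ?leq_addl //.
rewrite [in RHS]big_mkcond /=.
have -> : h = \prod_(1 <= i < (n + sumn s).+1 | i == n) h.
  by rewrite big_nat1_eq n0 ltnS leq_addr.
rewrite [X in X * _]big_mkcond -big_split /=; apply: eq_bigr => i _.
rewrite ltnS [n == i]eq_sym; have [->|ne] := eqVneq i n.
  by rewrite add1n fS; case: leqP => // /count0 ->; rewrite f0.
by rewrite add0n mul1r; case: leqP => // /count0 ->; rewrite f0.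
Qed.

Section PartitionSums.
Variable K : fieldType.
Hypothesis charK : forall n, n.+1%:R != 0 :> K.

Lemma zpart_cons n s : (0 < n)%N ->
  zpart K (n :: s) = (n * (count_mem n s).+1)%:R * zpart K s.
Proof.
move=> n0; rewrite /zpart !natr_prod.
apply: (prod_multiplicities_cons (f := fun i c => (i ^ c * c`!)%:R)) => //.
by rewrite -natrM expnS factS; congr _%:R; lia.
Qed.

Lemma perm_zpart s s' : perm_eq s s' -> zpart K s = zpart K s'.
Proof.
move=> h; rewrite /zpart (perm_sumn h); congr _%:R.
by apply: eq_bigr => i _; rewrite (permP h).
Qed.

Lemma zpart_neq0 s : 0%N \notin s -> zpart K s != 0.
Proof.
elim: s => [|n s IH] s0; first by rewrite /zpart big_geq // oner_neq0.
move: s0; rewrite inE negb_or eq_sym -lt0n => /andP[n0 s0].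
by rewrite zpart_cons // mulf_neq0 ?IH // -[(n * _)%N]prednK ?muln_gt0 ?n0 // charK.
Qed.

Lemma partitions0 : partitions 0 = [:: [::]].
Proof.
have : perm_eq (partitions 0) [:: [::]].
  apply: uniq_perm => // [|s]; first exact: partitions_uniq.
  rewrite mem_partitions inE /is_partition_of /is_partition.
  by case: s => // -[|a] s; rewrite /= ?andbF ?addSn ?andbF.
exact: perm_small_eq.
Qed.

Lemma notin_partitions n s : s \in partitions n -> 0%N \notin s.
Proof. by rewrite mem_partitions => /andP[/andP[]]. Qed.

Lemma geq_trans : transitive geq.
Proof. by move=> a b c ba ca; apply: leq_trans ca ba. Qed.

Lemma geq_total : total geq.
Proof. by move=> a b; apply: leq_total. Qed.

Lemma geq_anti : antisymmetric geq.
Proof. by move=> a b; rewrite andbC; apply: anti_leq. Qed.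

Lemma partitions_insert n k : (0 < k <= n)%N ->
  perm_eq [seq s <- partitions n | k \in s]
          [seq sort geq (k :: s) | s <- partitions (n - k)].
Proof.
move=> /andP[k0 kn]; apply: uniq_perm => [||s].
- by rewrite filter_uniq ?partitions_uniq.
- rewrite map_inj_in_uniq ?partitions_uniq // => s1 s2.
  rewrite !mem_partitions => /andP[/andP[s1s _] _] /andP[/andP[s2s _] _] e.
  apply: (sorted_eq geq_trans geq_anti) => //.
  by rewrite -(perm_cons k) -(perm_sort geq) e (perm_sort geq).
rewrite mem_filter mem_partitions; apply/andP/mapP => [[ks]|[s']].
  move=> /andP[/andP[ss s0] /eqP sn]; exists (rem k s).
    rewrite mem_partitions /is_partition_of /is_partition.
    rewrite (subseq_sorted geq_trans (rem_subseq k s)) //=.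
    rewrite (contra (@mem_rem _ k s 0%N)) //=.
    by rewrite -sn (perm_sumn (perm_to_rem ks)) /= addKn.
  apply: (sorted_eq geq_trans geq_anti) => //; first exact: sort_sorted geq_total _.
  by rewrite perm_sym perm_sort perm_sym perm_to_rem.
rewrite mem_partitions => /andP[/andP[ss s0] /eqP sn] ->.
rewrite mem_sort mem_head; split=> //.
rewrite /is_partition_of /is_partition sort_sorted; last exact: geq_total.
rewrite mem_sort inE negb_or eq_sym -lt0n k0 s0 /=.
by rewrite (perm_sumn (permEl (perm_sort geq _))) /= sn subnKC.
Qed.

Lemma sumn_multiplicities n s : is_partition_of n s ->
  n = (\sum_(k < n.+1) k * count (pred1 (nat_of_ord k)) s)%N.
Proof.
move=> /andP[_ /eqP sn].
have sle : all (fun i => (i <= n)%N) s.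
  by apply/allP => i si; rewrite -sn (perm_sumn (perm_to_rem si)) leq_addr.
rewrite -{1}sn; elim: s {sn} sle => [|a s IH] /=.
  by rewrite big1 // => k _; rewrite muln0.
move=> /andP[an /IH ->].
rewrite (eq_bigr (fun k : 'I_n.+1 =>
  (if k == a :> nat then a else 0) + k * count (pred1 (nat_of_ord k)) s)%N).
  by rewrite big_split /= -big_mkcond /= (big_ord1_eq _ (fun=> a)) ltnS an.
by move=> k _; rewrite mulnDr [a == k]eq_sym; case: eqP => [->|_]; rewrite ?muln1 ?muln0.
Qed.

Variable S : comAlgType K.
Variable a : nat -> S.

Definition partition_sum n : S :=
  \sum_(s <- partitions n) (zpart K s)^-1 *: \prod_(i <- s) a i.

(** This is the expansion of the exponential of the sum of a_n z^n / n over
    partitions.  Weight each partition s of n by n, the sum of its parts; the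
    contribution of the parts equal to k is, after removing one of them, a_k times
    the sum for n - k, because the ratio of the two values of z is k times the
    multiplicity of k. *)
Lemma newton_partition_sum : a 0%N = 0 -> newton a partition_sum.
Proof.
move=> a0; split=> [|n].
  by rewrite /partition_sum partitions0 big_seq1 big_nil /zpart big_geq // invr1 scale1r.
pose w s := (zpart K s)^-1 *: \prod_(i <- s) a i.
have -> : partition_sum n *+ n =
    \sum_(k < n.+1) \sum_(s <- partitions n) w s *+ (k * count (pred1 (nat_of_ord k)) s).
  rewrite exchange_big /= /partition_sum -sumrMnl big_seq [RHS]big_seq.
  apply: eq_bigr => s; rewrite mem_partitions => /sumn_multiplicities {1}->.
  by rewrite -sumrMnr.
apply: eq_bigr => -[[|k] kn] _ /=.
  by rewrite a0 mul0r big1 // => s _; rewrite mul0n.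
rewrite (bigID (fun s => k.+1 \in s)) /= [X in _ + X]big1 => [|s]; last first.
  by move=> /count_memPn ->; rewrite muln0.
rewrite addr0 -big_filter (perm_big _ (partitions_insert _)) //= big_map.
rewrite /partition_sum mulr_sumr big_seq [RHS]big_seq; apply: eq_bigr => s _.
rewrite /w (permP (permEl (perm_sort geq _))) (perm_zpart (permEl (perm_sort geq _))).
rewrite (perm_big _ (permEl (perm_sort geq _))) /= big_cons eqxx zpart_cons //.
rewrite -scalerAr scalerMnl; congr (_ *: _).
rewrite invfM -mulr_natr mulrAC mulVf ?mul1r //.
by rewrite -[(_ * _)%N]prednK // muln_gt0.
Qed.

End PartitionSums.

(** The case a_n = 1 of the partition expansion: the exponential of
    - log (1 - z) is the geometric series. *)
Lemma sum_inv_zpart (K : fieldType) n : (forall n, n.+1%:R != 0 :> K) ->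
  \sum_(s <- partitions n) (zpart K s)^-1 = 1.
Proof.
move=> charK.
pose a n := (0 < n)%:R : K.
have ha : newton a (fun=> 1).
  split=> // m; rewrite /conv big_ord_recl mul0r add0r.
  by rewrite (eq_bigr (fun=> 1)) ?sumr_const ?card_ord // => i _; rewrite mulr1.
have tf m (x : K) : x *+ m.+1 = 0 -> x = 0.
  by move/eqP; rewrite -mulr_natr mulf_eq0 (negPf (charK m)) orbF => /eqP.
have := newton_uniq tf (erefl (a 0%N)) (@newton_partition_sum K charK K^o a erefl) ha n.
move=> <-; rewrite /partition_sum big_seq [RHS]big_seq; apply: eq_bigr => s.
rewrite mem_partitions => /andP[/andP[_ s0] _].
rewrite big1_seq => [|i /andP[_ si]]; first by rewrite [RHS]mulr1.
by rewrite /a lt0n; case: eqP si s0 => // -> ->.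
Qed.

(** * Sums over subpartitions *)

Lemma big_subpartitions_cons (V : nmodType) x s (F : seq nat -> V) :
  \sum_(u <- subpartitions (x :: s)) F u =
  \sum_(u <- subpartitions s) (F (x :: u) + F u).
Proof.
rewrite /subpartitions !big_image /=.
pose f (bt : bool * (size s).-tuple bool) : (size s).+1.-tuple bool := [tuple of bt.1 :: bt.2].
rewrite (reindex f) /=; last first.
  exists (fun b => (thead b, [tuple of behead b])) => [[b u] _|b _] /=.
    by congr (_, _); apply: val_inj.
  by rewrite [RHS]tuple_eta; apply: val_inj.
rewrite -(pair_bigA _ (fun b (u : (size s).-tuple bool) => F (mask (b :: u) (x :: s)))) /=.
by rewrite big_bool -big_split.
Qed.

Lemma subpartitions_nil : subpartitions [::] = [:: [::]].
Proof.
rewrite /subpartitions /image_mem (eq_map (g := fun=> [::])); last by move=> b; case: (tval b).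
have : size (enum {: 0.-tuple bool}) = 1%N by rewrite -cardE card_tuple expn0.
by case: (enum _) => [|? []].
Qed.

Lemma big_subpartitions_cond_cons (V : nmodType) x s (P : pred (seq nat)) (F : seq nat -> V) :
  \sum_(u <- subpartitions (x :: s) | P u) F u =
  \sum_(u <- subpartitions s | P (x :: u)) F (x :: u) +
  \sum_(u <- subpartitions s | P u) F u.
Proof. by rewrite big_mkcond big_subpartitions_cons big_split -!big_mkcond. Qed.

Lemma sumn_subpartition s u : u \in subpartitions s -> (sumn u <= sumn s)%N.
Proof.
case/imageP => b _ ->; move: (tval b) => {b}; elim: s => [|x s IH] [|[] m] //=.
- by rewrite leq_add2l.
- exact: leq_trans (IH m) (leq_addl _ _).
Qed.

Lemma subset_subpartition s u : u \in subpartitions s -> {subset u <= s}.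
Proof. by case/imageP => b _ -> x; apply: mem_mask. Qed.

Lemma big_subpartitions_empty (V : nmodType) s (F : seq nat -> V) : 0%N \notin s ->
  \sum_(u <- subpartitions s | (sumn u <= 0)%N) F u = F [::].
Proof.
elim: s => [|x s IH]; first by rewrite subpartitions_nil big_mkcond big_seq1.
rewrite inE negb_or eq_sym -lt0n => /andP[x0 s0].
rewrite big_subpartitions_cond_cons IH // big_pred0 ?add0r // => u /=.
by rewrite leqn0 addn_eq0 eqn0Ngt x0.
Qed.

(** Reindexing by complementary subpartitions; the sum and the product are the
    only data of the complement that G sees. *)
Lemma big_subpartitions_compl (K : fieldType) (f : nat -> K) s (G : nat -> K -> K) :
  (forall i, i \in s -> f i != 0) ->
  \sum_(u <- subpartitions s) G (sumn u) (\prod_(i <- u) f i) =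
  \sum_(u <- subpartitions s)
     G (sumn s - sumn u)%N ((\prod_(i <- s) f i) / \prod_(i <- u) f i).
Proof.
elim: s G => [|x s IH] G fs.
  by rewrite subpartitions_nil !big_seq1 big_nil divr1.
have fx : f x != 0 by rewrite fs ?mem_head.
rewrite !big_subpartitions_cons.
pose H n y := G (x + n)%N (f x * y) + G n y.
transitivity (\sum_(u <- subpartitions s) H (sumn u) (\prod_(i <- u) f i)).
  by apply: eq_bigr => u _; rewrite big_cons.
rewrite IH => [|i si]; last by rewrite fs // inE si orbT.
apply: eq_big_seq => u /sumn_subpartition us; rewrite /H.
rewrite !big_cons /= subnDl addnBA // [RHS]addrC mulrA; congr (_ + G _ _).
by rewrite invfM mulrACA mulfV ?mul1r.
Qed.

Lemma big_subpartitions_prod (R : comNzRingType) (f : nat -> R) s :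
  \sum_(u <- subpartitions s) \prod_(i <- u) f i = \prod_(i <- s) (f i + 1).
Proof.
elim: s => [|x s IH]; first by rewrite subpartitions_nil big_seq1 !big_nil.
rewrite big_subpartitions_cons big_cons -IH mulr_sumr; apply: eq_bigr => u _.
by rewrite big_cons mulrDl mul1r.
Qed.

Lemma not0_cup u rho n s : u \in subpartitions s -> 0%N \notin s ->
  rho \in partitions n -> 0%N \notin cup_partition u rho.
Proof.
move=> /subset_subpartition us s0 /notin_partitions r0.
by rewrite mem_sort mem_cat (negPf r0) orbF; apply: contra s0 => /us.
Qed.

Lemma sumn_cup u rho n : rho \in partitions n ->
  sumn (cup_partition u rho) = (sumn u + n)%N.
Proof.
rewrite mem_partitions => /andP[_ /eqP <-].
by rewrite (perm_sumn (permEl (perm_sort geq _))) sumn_cat.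
Qed.

(** * Raising operators *)

Lemma Posz_sum I (r : seq I) (P : pred I) (F : I -> nat) :
  (\sum_(i <- r | P i) F i)%:Z = \sum_(i <- r | P i) (F i)%:Z.
Proof. exact: (big_morph Posz PoszD). Qed.

(** Raising exponents are bounded by the size of the partition, a bound that
    changes when a row is removed. *)
Lemma big_ffun_bound (V : nmodType) (I : finType) (F : {ffun I -> nat} -> V) M N :
  (M <= N)%N -> (forall (f : {ffun I -> nat}) i, (M < f i)%N -> F f = 0) ->
  \sum_(a : {ffun I -> 'I_N.+1}) F [ffun i => val (a i)] =
  \sum_(a : {ffun I -> 'I_M.+1}) F [ffun i => val (a i)].
Proof.
move=> MN F0.
rewrite (bigID (fun a : {ffun I -> 'I_N.+1} => [forall i, (a i <= M)%N])) /=.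
rewrite [X in _ + X]big1 => [|a]; last first.
  by case/forallPn => i; rewrite -ltnNge => Mi; apply: (F0 _ i); rewrite ffunE.
rewrite addr0 (reindex_onto (fun b : {ffun I -> 'I_M.+1} =>
    [ffun i => widen_ord (MN : (M.+1 <= N.+1)%N) (b i)])
  (fun a => [ffun i => inord (a i)])) /=.
  apply: eq_big => [b|b _].
    apply/andP; split; first by apply/forallP => i; rewrite ffunE /= -ltnS.
    by apply/eqP/ffunP => i; rewrite !ffunE /= inord_val.
  by congr F; apply/ffunP => i; rewrite !ffunE.
move=> a /forallP aM; apply/ffunP => i; apply: val_inj.
by rewrite !ffunE /= inordK // ltnS.
Qed.

Section ExponentArrays.
Variables (l : nat) (c : 'I_l -> nat).

Definition upper (f : {ffun 'I_l * 'I_l -> nat}) : bool :=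
  [forall ij : 'I_l * 'I_l, (ij.2 <= ij.1)%N ==> (f ij == 0%N)].

Definition raised_index (f : {ffun 'I_l * 'I_l -> nat}) (i : 'I_l) : int :=
  (c i)%:Z + \sum_(j < l | (i < j)%N) (f (i, j))%:Z
           - \sum_(j < l | (j < i)%N) (f (j, i))%:Z.

(** Raising operators between two indices of the final segment A preserve the
    sum over A; those from an index outside A to an index in A lower it. *)
Lemma sum_raised_index_tail (f : {ffun 'I_l * 'I_l -> nat}) (A : pred 'I_l) :
  (forall i j : 'I_l, A i -> (i < j)%N -> A j) ->
  \sum_(k | A k) raised_index f k =
  \sum_(k | A k) (c k)%:Z -
  \sum_(i | ~~ A i) \sum_(j < l | (i < j)%N && A j) (f (i, j))%:Z.
Proof.
move=> Aup; rewrite /raised_index sumrB big_split /= -addrA; congr (_ + _).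
rewrite [X in _ - X](exchange_big_dep predT) //= [X in _ - X](bigID A) /=.
rewrite opprD addrA -[RHS]add0r; congr (_ - _).
  apply/eqP; rewrite subr_eq0; apply/eqP; apply: eq_bigr => i Ai.
  apply: eq_bigl => j; case ij: (i < j)%N; rewrite ?andbF // (Aup i) //.
by apply: eq_bigr => i _; apply: eq_bigl => j; rewrite andbC.
Qed.

Lemma sum_raised_index (f : {ffun 'I_l * 'I_l -> nat}) :
  \sum_k raised_index f k = (\sum_k c k)%:Z.
Proof.
rewrite (@sum_raised_index_tail f predT) // [X in _ - X]big_pred0 // subr0.
by rewrite -Posz_sum.
Qed.

End ExponentArrays.

Lemma prod_upper_recl (R : comNzRingType) l (F : 'I_l.+1 * 'I_l.+1 -> R) :
  \prod_(ij : 'I_l.+1 * 'I_l.+1 | (ij.1 < ij.2)%N) F ij =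
  (\prod_j F (ord0, lift ord0 j)) *
  \prod_(ij : 'I_l * 'I_l | (ij.1 < ij.2)%N) F (lift ord0 ij.1, lift ord0 ij.2).
Proof.
have split n (H : 'I_n * 'I_n -> R) : \prod_(ij : 'I_n * 'I_n | (ij.1 < ij.2)%N) H ij =
    \prod_(i < n) \prod_(j < n | (i < j)%N) H (i, j).
  by rewrite pair_big_dep /=; apply: eq_bigr => -[].
rewrite !split big_ord_recl; congr (_ * _).
  by rewrite big_mkcond big_ord_recl /= mul1r.
apply: eq_bigr => i _; rewrite big_mkcond big_ord_recl /= mul1r [RHS]big_mkcond.
by apply: eq_bigr => j _; rewrite /= /bump !add1n ltnS.
Qed.

Section Bordering.
Variables (N l : nat).
Local Notation bounded n := {ffun 'I_n * 'I_n -> 'I_N.+1}.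

(** An upper triangular array of exponents for l + 1 indices is one for the last l
    indices together with its row 0. *)
Definition border (x : bounded l * {ffun 'I_l -> 'I_N.+1}) : bounded l.+1 :=
  [ffun ij => if unlift ord0 ij.2 is Some j then
      if unlift ord0 ij.1 is Some i then x.1 (i, j) else x.2 j
    else ord0].

Definition unborder (a : bounded l.+1) : bounded l * {ffun 'I_l -> 'I_N.+1} :=
  ([ffun ij => a (lift ord0 ij.1, lift ord0 ij.2)], [ffun j => a (ord0, lift ord0 j)]).

Lemma border0 x j : border x (ord0, lift ord0 j) = x.2 j.
Proof. by rewrite ffunE /= liftK unlift_none. Qed.

Lemma border_col0 x i : border x (i, ord0) = ord0.
Proof. by rewrite ffunE /= unlift_none. Qed.

Lemma border_lift x i j : border x (lift ord0 i, lift ord0 j) = x.1 (i, j).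
Proof. by rewrite ffunE /= !liftK. Qed.

Lemma borderK : cancel border unborder.
Proof.
move=> [a v]; congr (_, _); apply/ffunP => i; rewrite ffunE ?border0 //.
by case: i => i j; rewrite border_lift.
Qed.

Definition exponents n (a : bounded n) : {ffun 'I_n * 'I_n -> nat} :=
  [ffun ij => val (a ij)].

Lemma unborderK a : upper (exponents a) -> border (unborder a) = a.
Proof.
move=> /forallP up; apply/ffunP => -[i j]; rewrite ffunE /=.
have low (i' j' : 'I_l.+1) : (j' <= i')%N -> a (i', j') = ord0.
  by move=> ji; apply: val_inj; have := up (i', j'); rewrite /= ji ffunE => /eqP.
case: unliftP => [j'|] -> /=; last by rewrite low.
by case: unliftP => [i'|] -> /=; rewrite ffunE.
Qed.

Lemma upper_border x : upper (exponents (border x)) = upper (exponents x.1).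
Proof.
apply/forallP/forallP => up [i j] /=; rewrite ffunE.
  have := up (lift ord0 i, lift ord0 j).
  by rewrite /= /bump !add1n ltnS ffunE border_lift.
case: (unliftP ord0 j) => [j'|] ->; last by rewrite border_col0 eqxx implybT.
case: (unliftP ord0 i) => [i'|] -> //=.
rewrite border_lift; have := up (i', j').
by rewrite /= /bump !add1n ltnS ffunE.
Qed.

Variable c : 'I_l.+1 -> nat.
Local Notation c' := (fun i => c (lift ord0 i)).

Lemma raised_index_border0 x :
  raised_index c (exponents (border x)) ord0 = (c ord0 + \sum_j x.2 j)%N.
Proof.
rewrite /raised_index [X in _ - X]big_pred0 // subr0 big_mkcond big_ord_recl /= add0r.
rewrite PoszD Posz_sum; congr (_ + _); apply: eq_bigr => j _.
by rewrite ffunE border0.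
Qed.

Lemma raised_index_border_lift x i :
  raised_index c (exponents (border x)) (lift ord0 i) =
  raised_index c' (exponents x.1) i - (x.2 i : nat)%:Z.
Proof.
rewrite /raised_index.
have -> : \sum_(j < l.+1 | (lift ord0 i < j)%N) (exponents (border x) (lift ord0 i, j))%:Z =
    \sum_(j < l | (i < j)%N) (exponents x.1 (i, j))%:Z.
  rewrite big_mkcond big_ord_recl /= add0r [RHS]big_mkcond; apply: eq_bigr => j _.
  by rewrite /= /bump !add1n ltnS ffunE border_lift ffunE.
have -> : \sum_(j < l.+1 | (j < lift ord0 i)%N) (exponents (border x) (j, lift ord0 i))%:Z =
    (x.2 i : nat)%:Z + \sum_(j < l | (j < i)%N) (exponents x.1 (j, i))%:Z.
  rewrite big_mkcond big_ord_recl /= ffunE border0 [X in _ = _ + X]big_mkcond.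
  congr (_ + _); apply: eq_bigr => j _.
  by rewrite /= /bump !add1n ltnS ffunE border_lift ffunE.
by rewrite opprD addrA addrAC.
Qed.

End Bordering.

(** * Vertex operators *)

(** The ring S is the polynomial ring on p_1, p_2, ..., known only through its
    generators, through the two letter morphisms and through the constant term;
    sigma adds a letter to the alphabet and tau removes one. *)
Section VertexOperators.
Variables (K : fieldType) (t : K) (S : comAlgType K) (p q : nat -> S).
Variables (sigma tau : {rmorphism S -> {poly S}}) (eps : {rmorphism S -> K}).
Hypothesis charK : forall n, n.+1%:R != 0 :> K.
Hypothesis tK : forall i, 1 - t ^+ i.+1 != 0.
Hypothesis S_ind : forall P : S -> Prop,
  P 1 -> (forall f g, P f -> P g -> P (f + g)) ->
  (forall c f, P f -> P (c *: f)) ->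
  (forall n f, P f -> P (p n.+1 * f)) -> forall f, P f.
Hypothesis sigmaA : forall c : K, sigma c%:A = (c%:A)%:P.
Hypothesis tauA : forall c : K, tau c%:A = (c%:A)%:P.
Hypothesis epsA : forall c : K, eps c%:A = c.
Hypothesis sigma_p : forall n, sigma (p n.+1) = (p n.+1)%:P + 'X^(n.+1).
Hypothesis tau_p : forall n, tau (p n.+1) = (p n.+1)%:P - 'X^(n.+1).
Hypothesis eps_p : forall n, eps (p n.+1) = 0.
Hypothesis q_newton : newton (fun n => (1 - t ^+ n) *: p n) q.

Definition g := partition_sum (fun n => - ((1 - t ^+ n) *: p n)).

Lemma g_newton : newton (fun n => - ((1 - t ^+ n) *: p n)) g.
Proof. by apply: newton_partition_sum; rewrite // expr0 subrr scale0r oppr0. Qed.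

Implicit Types (f : S) (P : {poly S}) (u : nat -> S).

Lemma sigmaZ c f : sigma (c *: f) = (c%:A)%:P * sigma f.
Proof. by rewrite -[c *: f]mulr_algl rmorphM /= sigmaA. Qed.

Lemma tauZ c f : tau (c *: f) = (c%:A)%:P * tau f.
Proof. by rewrite -[c *: f]mulr_algl rmorphM /= tauA. Qed.

Lemma epsZ c f : eps (c *: f) = c * eps f.
Proof. by rewrite -[c *: f]mulr_algl rmorphM /= epsA. Qed.

Lemma coef_sigmaZ c f i : (sigma (c *: f))`_i = c *: (sigma f)`_i.
Proof. by rewrite sigmaZ coefCM mulr_algl. Qed.

Lemma coef_tauZ c f i : (tau (c *: f))`_i = c *: (tau f)`_i.
Proof. by rewrite tauZ coefCM mulr_algl. Qed.

Lemma coef_sigma_p n f i :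
  (sigma (p n.+1 * f))`_i =
  p n.+1 * (sigma f)`_i + (if (i < n.+1)%N then 0 else (sigma f)`_(i - n.+1)).
Proof. by rewrite rmorphM /= sigma_p mulrDl coefD coefCM coefXnM. Qed.

Lemma coef_tau_p n f i :
  (tau (p n.+1 * f))`_i =
  p n.+1 * (tau f)`_i - (if (i < n.+1)%N then 0 else (tau f)`_(i - n.+1)).
Proof. by rewrite rmorphM /= tau_p mulrBl coefB coefCM coefXnM. Qed.

Lemma sigma_tau_comm f i j : (sigma (tau f)`_j)`_i = (tau (sigma f)`_i)`_j.
Proof.
elim/S_ind: f i j => [|f h Hf Hh|c f Hf|n f Hf] i j.
- by rewrite !rmorph1 !coef1 !rmorph_nat !coefMn !coef1 mulrnAC.
- by rewrite !rmorphD !coefD !rmorphD !coefD Hf Hh.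
- by rewrite coef_tauZ !coef_sigmaZ coef_tauZ Hf.
rewrite coef_tau_p coef_sigma_p rmorphB rmorphD coefB coefD coef_sigma_p coef_tau_p.
rewrite Hf addrAC; congr (_ + _ + _).
  by case: ifP => _; rewrite ?rmorph0 ?coef0 ?Hf.
by case: ifP => _; rewrite ?rmorph0 ?coef0 ?Hf.
Qed.

(** Removing a letter and adding the same letter again changes nothing. *)
Lemma tau_sigma_id f :
  \sum_(j < size (tau f)) sigma (tau f)`_j * 'X^j = f%:P.
Proof.
transitivity (map_poly sigma (tau f)).['X].
  by rewrite /map_poly horner_poly.
elim/S_ind: f => [|f h Hf Hh|c f Hf|n f Hf].
- by rewrite !rmorph1 hornerC.
- by rewrite !rmorphD /= hornerD Hf Hh.
- by rewrite tauZ rmorphM /= hornerM Hf map_polyC /= hornerC sigmaA -polyCM mulr_algl.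
rewrite rmorphM rmorphM hornerM Hf /= tau_p rmorphB hornerD hornerN.
by rewrite /= map_polyC /= hornerC map_polyXn hornerXn sigma_p addrK polyCM.
Qed.

(** * Adding a letter to q_n *)

(** The function q with index m - n in the integers, which is 0 when this is
    negative. *)
Definition q_sub m n := if (n <= m)%N then q (m - n)%N else 0.

(** A morphism that translates the power sums multiplies the exponential q(z) by
    the exponential of the translation. *)
Lemma coef_morph_q (h : {rmorphism S -> {poly S}}) (c s : nat -> K) :
  newton c s ->
  (forall n, h ((1 - t ^+ n) *: p n) =
     ((1 - t ^+ n) *: p n)%:P + ((c n)%:A)%:P * 'X^n) ->
  forall n k, (h (q n))`_k = s k *: q_sub n k.
Proof.
move=> cs hp n k.
pose d i : {poly S} := ((c i)%:A)%:P * 'X^i.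
pose e i : {poly S} := ((s i)%:A)%:P * 'X^i.
have de : newton d e.
  apply: newton_scale.
  exact: (newton_morph (polyC \o in_alg S) cs).
have sum : newton (fun i => d i + ((1 - t ^+ i) *: p i)%:P) (conv e (polyC \o q)).
  by apply: newton_conv => //; apply: newton_morph.
have := newton_morph h q_newton.
move=> [hq0 hqS].
have hq : newton (fun i => d i + ((1 - t ^+ i) *: p i)%:P) (h \o q).
  split=> // m; rewrite hqS; apply: eq_conv => // i _ /=.
  by rewrite hp addrC.
have a0 : d 0%N + ((1 - t ^+ 0) *: p 0)%:P = 0.
  by rewrite addrC -hp expr0 subrr scale0r rmorph0.
rewrite -[h (q n)]/((h \o q) n).
rewrite (newton_uniq (@poly_torsionfree K S charK) a0 hq sum) coef_sum.
rewrite (eq_bigr (fun i : 'I_n.+1 => if val i == k then s i *: q (n - i)%N else 0)).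
  rewrite -big_mkcond /= (big_ord1_eq _ (fun i => s i *: q (n - i)%N)).
  by rewrite /q_sub ltnS; case: ifP; rewrite ?scaler0.
move=> i _ /=; rewrite /e -mulrA [X in _ * X]mulrC !coefCM coefXn mulr_algl eq_sym.
by case: eqP => _; rewrite ?mulr1 ?mulr0 ?scaler0.
Qed.

Lemma coef_sigma_q n k : (sigma (q n))`_k = scattering_coef t k *: q_sub n k.
Proof.
apply: (coef_morph_q (newton_scattering t)) => -[|i].
  by rewrite expr0 subrr !scale0r rmorph0 mul0r addr0.
rewrite sigmaZ sigma_p mulrDr -!polyCM mulr_algl; congr (_ + _).
Qed.

(** The sequence is that of (1 - z) / (1 - t z), and its partial sums telescope to
    the powers of t. *)
Lemma newton_raising : newton (fun i => - (1 - t ^+ i)) (raising_coef t).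
Proof.
split=> [|n]; first by rewrite /raising_coef subr0.
have tele m : \sum_(i < m.+1) raising_coef t i = t ^+ m.
  elim: m => [|m IH]; first by rewrite big_ord1 /raising_coef subr0.
  by rewrite big_ord_recr /= IH /raising_coef /= addrC subrK.
rewrite convC /conv (eq_bigr (fun i : 'I_n.+1 =>
   raising_coef t i * t ^+ (n - i) - raising_coef t i)) => [|i _]; last first.
  by rewrite opprB mulrBr mulr1.
rewrite sumrB tele big_ord_recl /= /raising_coef /= !subr0 subn0 mul1r.
rewrite (eq_bigr (fun=> t ^+ n - t ^+ n.-1)) => [|i _].
  rewrite sumr_const card_ord addrAC subrr add0r.
  by case: n => [|n]; rewrite // !mulr0n.
rewrite /= /bump /= add1n mulrBl -!exprD; congr (t ^+ _ - t ^+ _).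
  by rewrite subnKC.
by case: i => i /=; case: n {tele} => // n le_in; rewrite subSS subnKC.
Qed.

Lemma coef_tau_q n k : (tau (q n))`_k = raising_coef t k *: q_sub n k.
Proof.
apply: (coef_morph_q newton_raising) => -[|i].
  by rewrite expr0 subrr oppr0 !scale0r rmorph0 mul0r addr0.
by rewrite tauZ tau_p mulrBr -!polyCM mulr_algl scaleNr polyCN mulNr.
Qed.

Lemma q0 : q 0%N = 1.
Proof. by case: q_newton. Qed.

Lemma conv_qg n : conv q g n = (n == 0%N)%:R.
Proof.
apply: (newton_inverse (@torsionfree K S charK) _ q_newton g_newton).
by rewrite expr0 subrr scale0r.
Qed.

Lemma g0 : g 0%N = 1.
Proof. by case: g_newton. Qed.

Lemma eps_q n : eps (q n.+1) = 0.
Proof.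
have [_ /(_ n.+1) /(congr1 eps)] := q_newton.
rewrite rmorphMn rmorph_sum big1 => [|[[|i] ?] _] /=.
- by move/eqP; rewrite -mulr_natr mulf_eq0 (negPf (charK n)) orbF => /eqP.
- by rewrite expr0 subrr scale0r mul0r rmorph0.
- by rewrite rmorphM /= epsZ eps_p mulr0 mul0r.
Qed.

(** * Creation and annihilation operators *)

(** The linear functional in the variable of P that sends its i-th power to u_i.
    Extracting a coefficient from the product of a Laurent series with a
    polynomial in the inverse variable has this form. *)
Definition umbral u P : S := \sum_(i < size P) u i * P`_i.

Lemma umbral_wide u P N : (forall i, (N <= i)%N -> P`_i = 0) ->
  umbral u P = \sum_(i < N) u i * P`_i.
Proof.
move=> /leq_sizeP PN; rewrite /umbral.
rewrite (big_ord_widen N (fun i => u i * P`_i) PN) big_mkcond /=.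
by apply: eq_bigr => i _; case: ltnP => // /(nth_default 0) ->; rewrite mulr0.
Qed.

Lemma umbralD u P Q : umbral u (P + Q) = umbral u P + umbral u Q.
Proof.
pose N := maxn (size P) (size Q).
have PN : (size P <= N)%N by rewrite leq_maxl.
have QN : (size Q <= N)%N by rewrite leq_maxr.
rewrite !(@umbral_wide _ _ N) -?big_split /=; try apply/leq_sizeP => //.
  by apply: eq_bigr => i _; rewrite coefD mulrDr.
by rewrite (leq_trans (size_polyD _ _)).
Qed.

Lemma umbral0 u : umbral u 0 = 0.
Proof. by rewrite /umbral size_poly0 big_ord0. Qed.

Lemma umbral_sum u I (r : seq I) (A : pred I) F :
  umbral u (\sum_(i <- r | A i) F i) = \sum_(i <- r | A i) umbral u (F i).
Proof. exact: (big_morph _ (umbralD u) (umbral0 u)). Qed.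

Lemma umbralC u f : umbral u f%:P = u 0%N * f.
Proof.
rewrite (@umbral_wide _ _ 1) ?big_ord1 ?coefC //.
by move=> [|i]; rewrite // coefC.
Qed.

Lemma umbralCM u f P : umbral u (f%:P * P) = f * umbral u P.
Proof.
rewrite (@umbral_wide _ _ (size P)) => [|i /(nth_default 0) h]; last first.
  by rewrite coefCM h mulr0.
by rewrite mulr_sumr; apply: eq_bigr => i _; rewrite coefCM mulrCA.
Qed.

Lemma umbralMXn u P n : umbral u (P * 'X^n) = umbral (fun i => u (i + n)%N) P.
Proof.
rewrite (@umbral_wide _ _ (n + size P)) => [|i h]; last first.
  rewrite coefMXn ltnNge (leq_trans (leq_addr _ _) h) /=.
  by rewrite nth_default // leq_subRL // (leq_trans (leq_addr _ _) h).
rewrite big_split_ord /= big1 => [|i _]; last by rewrite coefMXn ltn_ord mulr0.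
rewrite add0r; apply: eq_bigr => i _.
by rewrite coefMXn ltnNge leq_addr addKn addnC.
Qed.

(** The coefficient of z^m in q(z) f(p_n - z^(-n)). *)
Definition creation m f := umbral (fun j => q (m + j)%N) (tau f).

(** The function g with index i - n in the integers. *)
Definition g_shift n i := if (n <= i)%N then g (i - n)%N else 0.

(** The coefficient of w^n in g(1/w) f(p_n + w^n). *)
Definition annihilation n f := umbral (g_shift n) (sigma f).

(** Adding the letter w after the creation operator of parameter z multiplies by
    (1 - t w z) / (1 - w z) = t + (1 - t) (1 + w z + w^2 z^2 + ...).  The term t
    gives t times the creation operator applied to the coefficient of f.  In the
    other one, up to the factor 1 - t, all the coefficients of f contribute since
    none has degree above k: the letter removed by tau and the letter added by
    sigma act as equal letters, they cancel ([tau_sigma_id]), and q_(m - k) f is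
    left, which is f if m = k and 0 if m < k. *)
Lemma sigma_creation m k f : (m <= k)%N ->
  (forall l, (k < l)%N -> (sigma f)`_l = 0) ->
  (sigma (creation m f))`_k =
    (if m == k then (1 - t) *: f else 0) + t *: creation m (sigma f)`_k.
Proof.
move=> mk vf; set N := size (tau f).
pose B j := sigma (tau f)`_j.
have BE j l : (B j)`_l = (tau (sigma f)`_l)`_j by rewrite /B sigma_tau_comm.
have Bv j l : (k < l)%N -> (B j)`_l = 0 by move=> /vf e; rewrite BE e rmorph0 coef0.
have -> : creation m (sigma f)`_k = \sum_(j < N) q (m + j)%N * (B j)`_k.
  rewrite /creation (@umbral_wide _ _ N) => [|j Nj]; last first.
    by rewrite -BE /B (nth_default 0 Nj) rmorph0 coef0.
  by apply: eq_bigr => j _; rewrite BE.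
(* The sum is the umbral image of the product of the two letter morphisms with
   both letters equal to 'X, that is, of the constant polynomial f. *)
have <- : \sum_(j < N) (1 - t) *: umbral (fun i => q_sub (m + i) k) (B j * 'X^j) =
    (if m == k then (1 - t) *: f else 0).
  rewrite -scaler_sumr -umbral_sum tau_sigma_id umbralC addn0 /q_sub.
  have [->|ne] := eqVneq m k; first by rewrite leqnn subnn q0 mul1r.
  by rewrite leqNgt ltn_neqAle ne mk /= mul0r scaler0.
rewrite scaler_sumr -big_split /creation [umbral _ (tau f)]/umbral -/N rmorph_sum coef_sum /=.
apply: eq_bigr => j _; rewrite rmorphM coefMr umbralMXn.
rewrite (@umbral_wide _ _ k.+1) => [|l]; last exact: Bv.
rewrite !big_ord_recr /= subnn coef_sigma_q scalerDr -addrA; congr (_ + _).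
  rewrite scaler_sumr; apply: eq_bigr => i _.
  rewrite coef_sigma_q /scattering_coef subn_eq0 leqNgt ltn_ord mulr0n add0r.
  rewrite -scalerAl; congr (_ *: (_ * _)); rewrite /q_sub leq_subLR addnCA.
  by case: ifP => // _; rewrite subnBA 1?ltnW // -addnA [(j + i)%N]addnC.
rewrite /q_sub subn0 addnCA leq_addr addKn /scattering_coef mulr1n -/(B j).
by rewrite -scalerAl addrC -scalerDl [t + _]addrC.
Qed.

(** When f has degree at most n in the added letter, only the constant
    coefficient of g contributes to the annihilation operator. *)
Lemma annihilation_small n f : (forall k, (n < k)%N -> (sigma f)`_k = 0) ->
  annihilation n f = (sigma f)`_n.
Proof.
move=> vf; rewrite /annihilation (@umbral_wide _ _ n.+1) => [|l /vf] //.
rewrite big_ord_recr big1 /= => [|i _]; last by rewrite /g_shift leqNgt ltn_ord mul0r.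
by rewrite add0r /g_shift leqnn subnn g0 mul1r.
Qed.

(** The left side is the convolution of q and g in degree m + l - n > 0, which
    vanishes, without the terms in q_k for k > m. *)
Lemma g_shift_conv n m l : (n < m)%N ->
  \sum_(i < m.+1) g_shift n (i + l) * q (m - i)%N =
  - \sum_(k < (m + l - n).+1 | (m < k)%N) q k * g (m + l - n - k)%N.
Proof.
move=> nm; set D := (m + l - n)%N.
apply/eqP; rewrite -addr_eq0; apply/eqP.
transitivity (conv q g D); last by rewrite conv_qg; have -> : (D == 0)%N = false by lia.
rewrite /conv [RHS](bigID (fun k : 'I_D.+1 => (k <= m)%N)) /=; congr (_ + _); last first.
  by apply: eq_bigl => k; rewrite ltnNge.
pose F k := if (k <= D)%N && (k <= m)%N then q k * g (D - k)%N else 0.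
transitivity (\sum_(k < m.+1) F k).
  rewrite (reindex_inj rev_ord_inj); apply: eq_bigr => -[k /= lt_km] _.
  have km : (k <= m)%N := lt_km.
  rewrite subSS subKn // /g_shift /F km andbT mulrC.
  have -> : (n <= m - k + l)%N = (k <= D)%N by lia.
  case: ifP => kD; last by rewrite mulr0.
  by congr (_ * g _); lia.
transitivity (\sum_(k < D.+1) F k); last first.
  rewrite [RHS]big_mkcond; apply: eq_bigr => k _.
  by rewrite /F -ltnS ltn_ord.
rewrite -!(big_mkord xpredT F).
rewrite (@big_cat_nat _ _ _ (minn m D).+1 0 m.+1) //=; last by lia.
rewrite (@big_cat_nat _ _ _ (minn m D).+1 0 D.+1) //=; last by lia.
congr (_ + _); rewrite !big1_seq // => k; rewrite mem_index_iota => /andP[_ h];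
  rewrite /F; case: ifP => //; lia.
Qed.

Section Functional.
Variables (phi : {additive S -> K}) (n : nat).

(** Vanishing on the products with q_m for every m > n; for the functional
    <Q_lam, .> this expresses that lam_1 is at most n. *)
Definition kills_above := forall m f, (n < m)%N -> phi (q m * f) = 0.

(** Adding a letter to q_m gives t q_m plus 1 - t times a sum of q_(m - i) w^i.
    Against g(1/w) the latter recombines, since g is inverse to q, into multiples
    of q_k with k > m ([g_shift_conv]), and phi kills these and those of q_m. *)
Lemma kills_above_annihilation : kills_above ->
  forall m f, (n < m)%N -> phi (annihilation n (q m * f)) = 0.
Proof.
move=> kphi m f nm; rewrite /annihilation rmorphM /=.
rewrite -[sigma f]coefK poly_def mulr_sumr umbral_sum raddf_sum big1 // => l _.
rewrite -mul_polyC mulrCA umbralCM umbralMXn (@umbral_wide _ _ m.+1); last first.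
  by move=> i mi; rewrite coef_sigma_q /q_sub leqNgt mi scaler0.
set x := (sigma f)`_l.
rewrite (eq_bigr (fun i : 'I_m.+1 => t *: (if val i == 0%N then g_shift n l * q m else 0) +
     (1 - t) *: (g_shift n (i + l) * q (m - i)%N))) => [|i _]; last first.
  rewrite coef_sigma_q /scattering_coef [(t *+ _ + _) *: _]scalerDl mulrDr.
  rewrite -!scalerAr /q_sub -ltnS ltn_ord; congr (_ + _).
  by case: eqP => [->|_]; rewrite ?mulr1n ?subn0 // mulr0n scale0r scaler0.
rewrite big_split /= -!scaler_sumr g_shift_conv // big_ord_recl /= big1 // addr0.
rewrite mulrDr raddfD /= [_ * q m]mulrC scalerAr mulrCA kphi // add0r.
rewrite scalerN mulrN raddfN scaler_sumr mulr_sumr raddf_sum big1 ?oppr0 // => k mk.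
by rewrite /= scalerAr mulrCA kphi // (ltn_trans nm).
Qed.

Lemma kills_above_creation m f : kills_above -> (n < m)%N -> phi (creation m f) = 0.
Proof.
move=> kphi nm; rewrite /creation /umbral raddf_sum big1 // => i _.
by rewrite /= kphi // (leq_trans nm) // leq_addr.
Qed.

End Functional.

(** * Orthogonality of the Hall-Littlewood functions *)

Lemma umbralZ u c P : umbral u ((c%:A)%:P * P) = c *: umbral u P.
Proof. by rewrite umbralCM mulr_algl. Qed.

Lemma creationZ m c f : creation m (c *: f) = c *: creation m f.
Proof. by rewrite /creation tauZ umbralZ. Qed.

Lemma creation0 m : creation m 0 = 0.
Proof. by rewrite /creation rmorph0 umbral0. Qed.

Lemma annihilation_is_linear n : linear (annihilation n).
Proof.
by move=> c f h; rewrite /annihilation rmorphD /= umbralD sigmaZ umbralZ.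
Qed.

HB.instance Definition _ n :=
  GRing.isLinear.Build K S S *:%R (annihilation n) (annihilation_is_linear n).

(** The functional <Q_lam, f>, computed by moving the creation operators that
    build Q_lam to the other side of the form. *)
Fixpoint green_form lam f : K :=
  if lam is n :: lam' then green_form lam' (annihilation n f) else eps f.

Lemma green_form_is_scalar lam : scalar (green_form lam).
Proof.
elim: lam => [|n lam IH] c f h /=; first by rewrite rmorphD /= epsZ.
by rewrite linearP IH.
Qed.

HB.instance Definition _ lam :=
  GRing.isLinear.Build K S K *%R (green_form lam) (green_form_is_scalar lam).

Lemma kills_above_green_form n lam : path geq n lam -> kills_above (green_form lam) n.
Proof.
elim: lam n => [|n' lam IH] n /= => [_ m f|/andP[le_n' /IH h] m f nm].
  by case: m => // m _ /=; rewrite rmorphM /= eps_q mul0r.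
by apply: (kills_above_annihilation h); apply: leq_ltn_trans nm.
Qed.

Fixpoint HLfun lam : S := if lam is m :: lam' then creation m (HLfun lam') else 1.

(** Degree in the added letter is at most the first part: in [sigma_creation]
    every term vanishes beyond it. *)
Lemma sigma_HLfun_small n lam k : path geq n lam -> (n < k)%N ->
  (sigma (HLfun lam))`_k = 0.
Proof.
elim: lam n k => [|m lam IH] n k /=.
  by move=> _; case: k => // k _; rewrite rmorph1 coef1.
move=> /andP[mn lam_m] nk.
have mk : (m < k)%N by apply: leq_ltn_trans nk.
rewrite sigma_creation ?(ltnW mk) // => [|l kl]; last first.
  by apply: IH lam_m _; apply: ltn_trans kl.
by rewrite (IH m) // creation0 scaler0 ltn_eqF // addr0.
Qed.

(** Each of the equal first parts contributes (1 - t) t^i, i counting the equal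
    parts to its left, and 1 - t^m is the sum of these for multiplicity m. *)
Lemma sigma_HLfun_head m lam : (0 < m)%N -> path geq m lam ->
  (sigma (HLfun (m :: lam)))`_m =
  (1 - t ^+ (count_mem m (m :: lam))) *: HLfun lam.
Proof.
move=> m0; elim: lam => [|m' lam IH] lam_m.
  rewrite [HLfun _]/= sigma_creation ?leqnn // => [|l ml]; last first.
    by rewrite rmorph1 coef1 gtn_eqF // (leq_trans _ ml).
  by rewrite rmorph1 coef1 (gtn_eqF m0) mulr0n creation0 scaler0 addr0 /= !eqxx addn0 expr1.
have [m'm lam_m'] := andP lam_m.
rewrite -[HLfun (m :: _)]/(creation m (HLfun (m' :: lam))) sigma_creation ?leqnn //;
  last first.
  by move=> l ml; apply: sigma_HLfun_small ml.
rewrite eqxx.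
have [e|ne] := eqVneq m' m.
  subst m'; rewrite IH // creationZ /= eqxx scalerA -scalerDl.
  by congr (_ *: _); rewrite mulrBr mulr1 -exprS; ring.
have lt_m'm : (m' < m)%N by rewrite ltn_neqAle ne.
rewrite (sigma_HLfun_small (n := m')) ?leqnn //=; last by rewrite leqnn.
rewrite creation0 scaler0 addr0 eqxx (negPf ne) (_ : count_mem m lam = 0%N) ?expr1 //.
apply/count_memPn; apply: contraL lt_m'm => /(allP (order_path_min _ lam_m')) h.
by rewrite -leqNgt; apply: h => a b c ba cb; apply: leq_trans ba.
Qed.

(** The constant b_lam, with one factor for each part: the i-th part contributes
    through the number of parts equal to it from position i on. *)
Definition HLnorm lam : K :=
  \prod_(i < size lam) (1 - t ^+ count_mem (nth 0%N lam i) (drop i lam)).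

Lemma HLnorm_cons m lam :
  HLnorm (m :: lam) = (1 - t ^+ count_mem m (m :: lam)) * HLnorm lam.
Proof. by rewrite /HLnorm big_ord_recl. Qed.

Lemma is_partition_cons n lam : is_partition (n :: lam) ->
  [/\ (0 < n)%N, path geq n lam & is_partition lam].
Proof.
rewrite /is_partition inE negb_or eq_sym -lt0n => /and3P[h -> l0].
by split=> //; rewrite l0 (path_sorted h).
Qed.

(** Orthogonality of the Hall-Littlewood functions, by comparison of the first
    parts. *)
Lemma green_form_HLfun lam mu : is_partition lam -> is_partition mu ->
  green_form lam (HLfun mu) = if lam == mu then HLnorm lam else 0.
Proof.
elim: lam mu => [|n lam IH] [|m mu] pl pm.
- by rewrite /= rmorph1 /HLnorm big_ord0.
- have [m0 _ _] := is_partition_cons pm.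
  exact: (kills_above_creation _ (@kills_above_green_form 0 [::] isT)).
- have [n0 _ _] := is_partition_cons pl.
  have vanish k : (0 < k)%N -> (sigma (1 : S))`_k = 0.
    by case: k => // k _; rewrite rmorph1 coef1.
  rewrite /= annihilation_small ?vanish ?linear0 // => k nk.
  by rewrite vanish // (leq_trans _ nk).
have [[n0 pn pl'] [m0 pm' plm]] := (is_partition_cons pl, is_partition_cons pm).
case: (ltngtP n m) => nm.
- rewrite (kills_above_creation _ (@kills_above_green_form n (n :: lam) _)) //.
    by rewrite eqseq_cons ltn_eqF.
  by rewrite /= leqnn.
- have vanish k : (m < k)%N -> (sigma (HLfun (m :: mu)))`_k = 0.
    by apply: sigma_HLfun_small; rewrite /= leqnn.
  rewrite [LHS]/= annihilation_small => [|k nk]; last by apply: vanish; apply: ltn_trans nk.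
  by rewrite vanish // linear0 eqseq_cons gtn_eqF.
subst m; rewrite -[LHS]/(green_form lam (annihilation n (HLfun (n :: mu)))).
rewrite annihilation_small => [|k nk]; last first.
  by apply: sigma_HLfun_small nk; rewrite /= leqnn.
rewrite sigma_HLfun_head // linearZ /= IH // eqseq_cons eqxx /=.
case: eqP => [->|_]; last by rewrite mulr0.
by rewrite HLnorm_cons /= eqxx.
Qed.

(** * Annihilation of products of power sums *)

Definition pprod s : S := \prod_(i <- s) p i.

Lemma sigma_pprod s : 0%N \notin s ->
  sigma (pprod s) =
  \sum_(u <- subpartitions s) (pprod u)%:P * 'X^(sumn s - sumn u).
Proof.
elim: s => [|[|x] s IH] s0.
- by rewrite /pprod big_nil rmorph1 subpartitions_nil big_seq1 big_nil mulr1.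
- by rewrite inE in s0.
rewrite /pprod big_cons rmorphM /= sigma_p IH; last by move: s0; rewrite inE.
rewrite big_subpartitions_cons mulr_sumr; apply: eq_big_seq => u /sumn_subpartition us.
rewrite /pprod big_cons /= subnDl mulrDl polyCM mulrA; congr (_ + _).
by rewrite mulrCA -exprD addnBA.
Qed.

Lemma annihilation_pprod n s : 0%N \notin s -> (n <= sumn s)%N ->
  annihilation n (pprod s) =
  \sum_(u <- subpartitions s | (sumn u <= sumn s - n)%N)
     pprod u * g (sumn s - n - sumn u)%N.
Proof.
move=> s0 ns; rewrite /annihilation sigma_pprod // umbral_sum [RHS]big_mkcond.
apply: eq_big_seq => u /sumn_subpartition us.
rewrite umbralCM -['X^_]mul1r umbralMXn umbralC mulr1 /g_shift add0n.
have -> : (n <= sumn s - sumn u)%N = (sumn u <= sumn s - n)%N by lia.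
case: ifP => _; last by rewrite mulr0.
by congr (_ * g _); lia.
Qed.

Definition green_weight rho : K := (-1) ^+ size rho / zpart_t t rho.

Lemma green_weightE rho :
  green_weight rho = (zpart K rho)^-1 * \prod_(i <- rho) (t ^+ i - 1).
Proof.
rewrite /green_weight /zpart_t invfM invrK mulrCA; congr (_ * _).
elim: rho => [|i rho IH]; first by rewrite !big_nil mulr1.
by rewrite !big_cons -IH exprS mulrACA mulN1r opprB.
Qed.

Lemma gE n : g n = \sum_(rho <- partitions n) green_weight rho *: pprod rho.
Proof.
apply: eq_bigr => rho _; rewrite green_weightE -scalerA; congr (_ *: _).
by rewrite /pprod -scaler_prod; apply: eq_bigr => i _; rewrite -scaleNr opprB.
Qed.

Lemma pprod_cup nu rho : pprod (cup_partition nu rho) = pprod nu * pprod rho.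
Proof.
by rewrite /pprod (perm_big _ (permEl (perm_sort geq _))) /= big_cat.
Qed.

(** Removing the first row of the upper index: the sum over u records the power
    sums that did not turn into powers of the added letter, the sum over rho
    comes from g. *)
Lemma green_form_cons n lam s : 0%N \notin s -> (n <= sumn s)%N ->
  green_form (n :: lam) (pprod s) =
  \sum_(u <- subpartitions s | (sumn u <= sumn s - n)%N)
  \sum_(rho <- partitions (sumn s - n - sumn u))
     green_weight rho * green_form lam (pprod (cup_partition u rho)).
Proof.
move=> s0 ns; rewrite /= annihilation_pprod // linear_sum; apply: eq_bigr => u _.
rewrite gE mulr_sumr linear_sum; apply: eq_bigr => rho _.
by rewrite -scalerAr linearZ /= pprod_cup.
Qed.

Lemma green_form_row k s : 0%N \notin s -> sumn s = k ->
  green_form (drop_zeros [:: k]) (pprod s) = 1.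
Proof.
case: k => [|k] s0 sk /=.
  by case: s s0 sk => [|[]] //= _ _; rewrite /pprod big_nil rmorph1.
rewrite annihilation_pprod ?sk // subnn big_subpartitions_empty //.
by rewrite /pprod big_nil mul1r subnn g0 rmorph1.
Qed.

Lemma green_form_two_rows n k s : 0%N \notin s -> sumn s = (n + k)%N -> (k <= n)%N ->
  green_form (drop_zeros [:: n; k]) (pprod s) =
  \sum_(u <- subpartitions s | (sumn u <= k)%N)
  \sum_(rho <- partitions (k - sumn u)) green_weight rho.
Proof.
move=> s0 sk kn; have [n0|n0] := posnP n.
  have k0 : k = 0%N by apply/eqP; rewrite -leqn0 -n0.
  move: sk; rewrite n0 k0 => sk; rewrite big_subpartitions_empty //=.
  rewrite partitions0 big_seq1 green_weightE big_nil /zpart big_geq // invr1 mulr1.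
  by rewrite -[LHS]/(green_form (drop_zeros [:: 0%N]) _) green_form_row.
have -> : drop_zeros [:: n; k] = n :: drop_zeros [:: k] by rewrite /drop_zeros /= n0.
rewrite green_form_cons ?sk ?leq_addr // addKn big_seq_cond [RHS]big_seq_cond.
apply: eq_bigr => u /andP[su uk]; apply: eq_big_seq => rho r.
rewrite green_form_row ?mulr1 //; first exact: not0_cup su s0 r.
by rewrite (sumn_cup _ r) subnKC.
Qed.

Lemma green_form_three_rows k1 k2 k3 s : 0%N \notin s ->
  sumn s = (k1 + k2 + k3)%N -> (0 < k1)%N -> (k3 <= k2)%N ->
  green_form (drop_zeros [:: k1; k2; k3]) (pprod s) =
  \sum_(tau <- subpartitions s | (sumn tau <= k2 + k3)%N)
  \sum_(rho <- partitions (k2 + k3 - sumn tau))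
  \sum_(nu <- subpartitions (cup_partition tau rho) | (sumn nu <= k3)%N)
  \sum_(xi <- partitions (k3 - sumn nu))
    (-1) ^+ (size xi + size rho) / (zpart_t t xi * zpart_t t rho).
Proof.
move=> s0 sk k1_gt0 k32.
have -> : drop_zeros [:: k1; k2; k3] = k1 :: drop_zeros [:: k2; k3].
  by rewrite /drop_zeros /= k1_gt0.
rewrite green_form_cons ?sk -?addnA ?leq_addr // addKn big_seq_cond [RHS]big_seq_cond.
apply: eq_bigr => u /andP[su uk]; apply: eq_big_seq => rho r.
rewrite green_form_two_rows //; last 2 first.
- exact: not0_cup su s0 r.
- by rewrite (sumn_cup _ r) subnKC.
rewrite mulr_sumr; apply: eq_bigr => nu _; rewrite mulr_sumr; apply: eq_bigr => xi _.
by rewrite /green_weight exprD [in RHS]invfM mulrC mulrACA.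
Qed.

(** * Columns and hooks *)

Definition hook_sum k s : K :=
  \sum_(nu <- subpartitions s | (k <= sumn nu)%N) \prod_(j <- nu) (t ^+ j - 1).

Lemma prod_pow_sub1_neq0 s : 0%N \notin s -> \prod_(j <- s) (t ^+ j - 1) != 0.
Proof.
move=> s0; rewrite prodf_seq_neq0; apply/allP => -[|j] js /=; last first.
  by rewrite -opprB oppr_eq0.
by rewrite js in s0.
Qed.

Lemma sum_inv_subpartitions k m s : 0%N \notin s -> sumn s = (k + m)%N ->
  \sum_(nu <- subpartitions s | (sumn nu <= m)%N) (\prod_(j <- nu) (t ^+ j - 1))^-1 =
  (\prod_(j <- s) (t ^+ j - 1))^-1 * hook_sum k s.
Proof.
move=> s0 sk; rewrite /hook_sum mulr_sumr big_mkcond [RHS]big_mkcond /=.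
set A := \prod_(j <- s) _.
rewrite (big_subpartitions_compl (f := fun j => t ^+ j - 1)
  (fun n (y : K) => if (n <= m)%N then y^-1 else 0)) => [|j js]; last first.
  by have := prod_pow_sub1_neq0 s0; rewrite prodf_seq_neq0 => /allP/(_ j js).
apply: eq_big_seq => nu /sumn_subpartition nus.
have -> : (sumn s - sumn nu <= m)%N = (k <= sumn nu)%N by lia.
by case: ifP; rewrite // invfM invrK.
Qed.

(** The weight of rho is the product of the t^j - 1 over its parts, divided by
    z_rho; the product cancels the denominator of the column value, and the sum of
    1 / z_rho over rho is 1. *)
Lemma green_form_hook_of_column k m s : 0%N \notin s -> sumn s = (k + m)%N ->
  (forall s', 0%N \notin s' -> sumn s' = m ->
    green_form (nseq m 1%N) (pprod s') =
    \prod_(1 <= i < m.+1) (t ^+ i - 1) / \prod_(j <- s') (t ^+ j - 1)) ->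
  green_form (k :: nseq m 1%N) (pprod s) =
  \prod_(1 <= i < m.+1) (t ^+ i - 1) / \prod_(j <- s) (t ^+ j - 1) * hook_sum k s.
Proof.
move=> s0 sk column; rewrite green_form_cons ?sk ?leq_addr // addKn.
rewrite -mulrA -(sum_inv_subpartitions s0 sk) mulr_sumr.
rewrite big_seq_cond [RHS]big_seq_cond; apply: eq_bigr => nu /andP[nus num].
set A := \prod_(1 <= i < _) _.
rewrite -[RHS]mulr1 -[X in _ = _ * X](sum_inv_zpart (m - sumn nu) charK) mulr_sumr.
apply: eq_big_seq => rho r.
rewrite column; last 2 first.
- exact: not0_cup nus s0 r.
- by rewrite (sumn_cup _ r) subnKC.
rewrite (perm_big _ (permEl (perm_sort geq _))) /= big_cat /= green_weightE.
have rho0 : \prod_(j <- rho) (t ^+ j - 1) != 0.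
  exact: prod_pow_sub1_neq0 (notin_partitions r).
rewrite -/A invfM [LHS]mulrCA mulrACA divff // mulr1 -[RHS]mulrA; congr (_ * _).
by rewrite mulrC.
Qed.

(** A column is a hook with arm 1 on a shorter column.  The hook sum then runs
    over the nonempty subpartitions, and over all subpartitions the products of
    t^j - 1 add up to the product of the t^j, which is t^(m + 1). *)
Lemma green_form_column m s : 0%N \notin s -> sumn s = m ->
  green_form (nseq m 1%N) (pprod s) =
  \prod_(1 <= i < m.+1) (t ^+ i - 1) / \prod_(j <- s) (t ^+ j - 1).
Proof.
elim: m s => [|m IH] s s0 sm.
  case: s s0 sm => [|[]] //= _ _.
  by rewrite /pprod !big_nil rmorph1 divr1.
rewrite [nseq _ _]/= (green_form_hook_of_column (k := 1) (m := m)) //.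
rewrite [in RHS]big_nat_recr //= mulrAC; congr (_ * _).
rewrite /hook_sum.
have := big_subpartitions_prod (fun j => t ^+ j - 1) s.
rewrite (bigID (fun nu => (0 < sumn nu)%N)) /=.
under [X in _ + X]eq_bigl do rewrite -leqNgt.
rewrite big_subpartitions_empty // big_nil => /eqP.
rewrite eq_sym -subr_eq => /eqP <-; congr (_ * (_ - _)); under eq_bigr do rewrite subrK.
by rewrite -sm; elim: (s) => [|i s' IHs]; rewrite ?big_nil //= big_cons exprD IHs.
Qed.

Lemma green_form_hook k m s : 0%N \notin s -> sumn s = (k + m)%N ->
  green_form (k :: nseq m 1%N) (pprod s) =
  \prod_(1 <= i < m.+1) (t ^+ i - 1) / \prod_(j <- s) (t ^+ j - 1) * hook_sum k s.
Proof.
move=> s0 sk; apply: green_form_hook_of_column => // s'.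
exact: green_form_column.
Qed.

Lemma green_form_near_hook h1 h2 m s : 0%N \notin s -> sumn s = (h1 + h2 + m)%N ->
  green_form (h1 :: h2 :: nseq m 1%N) (pprod s) =
  \sum_(tau <- subpartitions s | (sumn tau <= h2 + m)%N)
  \sum_(rho <- partitions (h2 + m - sumn tau))
  \sum_(mu <- subpartitions (cup_partition tau rho)
        | (h2 <= sumn mu <= h2 + m)%N)
    (\prod_(1 <= i < m.+1) (t ^+ i - 1) * \prod_(l <- mu) (t ^+ l - 1)) /
    (zpart K rho * \prod_(j <- tau) (t ^+ j - 1)).
Proof.
move=> s0 sk; rewrite green_form_cons ?sk -?addnA ?leq_addr // addKn.
rewrite big_seq_cond [RHS]big_seq_cond.
apply: eq_bigr => nu /andP[nus num]; apply: eq_big_seq => rho r.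
have sc : sumn (cup_partition nu rho) = (h2 + m)%N by rewrite (sumn_cup _ r) subnKC.
rewrite green_form_hook //; last exact: not0_cup nus s0 r.
rewrite green_weightE (perm_big _ (permEl (perm_sort geq _))) /= big_cat /=.
have rho0 : \prod_(j <- rho) (t ^+ j - 1) != 0.
  exact: prod_pow_sub1_neq0 (notin_partitions r).
rewrite /hook_sum !mulr_sumr big_seq_cond [RHS]big_seq_cond; apply: eq_big => mu.
  case e: (mu \in _) => //=; move: e => /sumn_subpartition; rewrite sc => ->.
  by rewrite andbT.
by move=> _; field; rewrite rho0 -/(zpart K rho) (zpart_neq0 charK);
  rewrite ?prod_pow_sub1_neq0 ?(notin_partitions r) //;
  apply: contra s0; apply: subset_subpartition.
Qed.

(** * Raising operators as creation operators *)

Definition q_int (d : int) : S := if d is Posz n then q n else 0.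

(** A negative partial sum of the indices forces a negative index. *)
Lemma prod_q_int_eq0 (I : finType) (A : pred I) (d : I -> int) :
  \sum_(i | A i) d i < 0 -> \prod_i q_int (d i) = 0.
Proof.
move=> d0; have [i di] : exists i, d i < 0.
  apply/existsP; apply: contraLR d0; rewrite negb_exists => /forallP dn.
  by rewrite -leNgt sumr_ge0 // => i _; rewrite leNgt.
by rewrite (bigD1 i) //=; case: (d i) di => // n; rewrite mul0r.
Qed.

Lemma tau_q_int (d : int) N : d <= N%:Z ->
  tau (q_int d) = \sum_(v < N.+1) (raising_coef t v *: q_int (d - v%:Z))%:P * 'X^v.
Proof.
move=> dN; apply/polyP => k; rewrite coef_sum.
rewrite (eq_bigr (fun v : 'I_N.+1 =>
  if val v == k then raising_coef t v *: q_int (d - (val v)%:Z) else 0)) => [|v _]; last first.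
  by rewrite coefCM coefXn eq_sym; case: eqP => _; rewrite ?mulr1 ?mulr0.
rewrite -big_mkcond (big_ord1_eq _ (fun v => raising_coef t v *: q_int (d - v%:Z))).
case: d dN => n nN; last first.
  have -> : (Negz n - k%:Z)%R = Negz (n + k) by lia.
  by rewrite rmorph0 coef0 scaler0 if_same.
rewrite coef_tau_q /q_sub; case: (leqP k n) => kn.
  by rewrite (leq_ltn_trans kn) // subzn.
case: ifP => _; last by rewrite scaler0.
have -> : (n%:Z - k%:Z)%R = Negz (k - n).-1 by lia.
by [].
Qed.

(** Each factor scatters the removed letter with the coefficients of
    (1 - x) / (1 - t x), so that creation applies the raising operators
    between a new first index m and the indices d_i. *)
Lemma creation_prod_q_int m l (d : 'I_l -> int) N : \sum_i d i <= N%:Z ->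
  creation m (\prod_i q_int (d i)) =
  \sum_(v : {ffun 'I_l -> 'I_N.+1})
    (\prod_i raising_coef t (v i)) *:
      (q (m + \sum_i v i)%N * \prod_i q_int (d i - (val (v i))%:Z)).
Proof.
move=> dN.
pose F (v : {ffun 'I_l -> nat}) := (\prod_i raising_coef t (v i)) *:
      (q (m + \sum_i v i)%N * \prod_i q_int (d i - (v i)%:Z)).
(* A bound that is large enough for each factor; the product then vanishes
   beyond the smaller bound N. *)
pose M := (N + \sum_i `|d i|)%N.
transitivity (\sum_(a : {ffun 'I_l -> 'I_M.+1}) F [ffun i => val (a i)]).
  rewrite /creation rmorph_prod /=.
  rewrite (eq_bigr (fun i => \sum_(v < M.+1)
     (raising_coef t v *: q_int (d i - v%:Z))%:P * 'X^v)) => [|i _]; last first.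
    apply: tau_q_int; apply: (@le_trans _ _ `|d i|%N%:Z); first by lia.
    by rewrite lez_nat /M (bigD1 i) //= addnCA leq_addr.
  rewrite bigA_distr_bigA /= umbral_sum; apply: eq_bigr => v _.
  rewrite big_split /= -rmorph_prod /= umbralCM scaler_prod.
  rewrite prodrXr -['X^_]mul1r umbralMXn umbralC mulr1 add0n -scalerAl mulrC /F.
  by congr (_ *: (q (m + _) * _)); apply: eq_bigr => i _; rewrite ffunE.
rewrite (@big_ffun_bound _ _ F N) ?leq_addr // => [|v i Nv]; last first.
  rewrite /F (prod_q_int_eq0 (A := predT)) ?mulr0 ?scaler0 //.
  rewrite sumrB subr_lt0 (le_lt_trans dN) // -Posz_sum.
  by rewrite ltz_nat (bigD1 i) //= (leq_trans Nv) // leq_addr.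
apply: eq_bigr => v _; rewrite /F.
by congr (_ *: (q (m + _) * _)); apply: eq_bigr => i _; rewrite ffunE.
Qed.

Section RaisingSum.
Variables (l : nat) (c : 'I_l -> nat).

Definition raising_term (f : {ffun 'I_l * 'I_l -> nat}) : S :=
  if upper f then
    (\prod_(ij : 'I_l * 'I_l | (ij.1 < ij.2)%N) raising_coef t (f ij)) *:
      \prod_i q_int (raised_index c f i)
  else 0.

Definition raising_sum N : S :=
  \sum_(a : {ffun 'I_l * 'I_l -> 'I_N.+1}) raising_term (exponents a).

(** The entry f (i, j) lowers the sum of the indices from j on, whose initial
    value is at most M. *)
Lemma raising_term_eq0 (f : {ffun 'I_l * 'I_l -> nat}) i j M :
  (\sum_k c k <= M)%N -> (M < f (i, j))%N ->
  raising_term f = 0.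
Proof.
move=> cM Mf; rewrite /raising_term; case: ifP => // /forallP up.
have ij : (i < j)%N.
  by rewrite ltnNge; apply/negP => /(implyP (up (i, j))) /eqP e; rewrite e in Mf.
rewrite (prod_q_int_eq0 (A := fun k : 'I_l => (j <= k)%N)) ?scaler0 //.
rewrite sum_raised_index_tail => [|i' j' ji' ij']; last exact: leq_trans (ltnW ij').
rewrite subr_lt0 -Posz_sum.
under [ltRHS]eq_bigr do rewrite -Posz_sum.
rewrite -Posz_sum ltz_nat.
rewrite (leq_ltn_trans _ (leq_trans Mf _)) //.
  rewrite (leq_trans _ cM) //.
  by rewrite [X in (_ <= X)%N](bigID (fun k : 'I_l => (j <= k)%N)) leq_addr.
by rewrite (bigD1 i) -?ltnNge //= (bigD1 j) ?leqnn ?andbT //= -addnA leq_addr.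
Qed.

Lemma raising_sum_bound M N : (\sum_k c k <= M)%N -> (M <= N)%N ->
  raising_sum N = raising_sum M.
Proof.
move=> cM MN; apply: big_ffun_bound => // f [i j]; exact: raising_term_eq0.
Qed.

End RaisingSum.

Lemma creation_sum m I (r : seq I) (P : pred I) (F : I -> S) :
  creation m (\sum_(i <- r | P i) F i) = \sum_(i <- r | P i) creation m (F i).
Proof. by rewrite /creation rmorph_sum umbral_sum. Qed.

(** The exponents in row 0 are those with which the first index is raised, and
    summing over them is a creation operator. *)
Lemma raising_sum_cons l (c : 'I_l.+1 -> nat) N : (\sum_i c i <= N)%N ->
  raising_sum c N = creation (c ord0) (raising_sum (fun i => c (lift ord0 i)) N).
Proof.
move=> cN; set c' := fun i => c (lift ord0 i).
have c'N (f : {ffun 'I_l * 'I_l -> nat}) : \sum_i raised_index c' f i <= N%:Z.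
  rewrite sum_raised_index lez_nat (leq_trans _ cN) //.
  by rewrite [X in (_ <= X)%N]big_ord_recl leq_addl.
rewrite /raising_sum creation_sum /raising_term -big_mkcond /=.
rewrite (reindex_onto (@border N l) (@unborder N l)) /= => [|a]; last exact: unborderK.
under eq_bigl => x do rewrite borderK eqxx andbT upper_border.
transitivity (\sum_(a : {ffun 'I_l * 'I_l -> 'I_N.+1} | upper (exponents a))
   creation (c ord0)
     ((\prod_(ij : 'I_l * 'I_l | (ij.1 < ij.2)%N) raising_coef t (exponents a ij)) *:
      \prod_i q_int (raised_index c' (exponents a) i))); last first.
  rewrite big_mkcond; apply: eq_bigr => a _.
  by case: ifP; rewrite ?creation0.
rewrite [RHS](eq_bigr _ (fun a _ => creationZ _ _ _)).
under [RHS]eq_bigr => a _ do rewrite (creation_prod_q_int _ (c'N _)) scaler_sumr.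
rewrite pair_big /=; apply: eq_big => [x|x _]; first by rewrite andbT.
rewrite prod_upper_recl big_ord_recl raised_index_border0 [RHS]scalerA.
congr (_ *: (_ * _)).
  rewrite mulrC; congr (_ * _); apply: eq_bigr => -[i j] _ /=; rewrite ffunE ?border0 //.
  by rewrite border_lift ffunE.
by apply: eq_bigr => i _; rewrite raised_index_border_lift.
Qed.

Definition HL_raising lam : S :=
  raising_sum (fun i : 'I_(size lam) => nth 0%N lam i) (sumn lam).

Lemma HL_raisingE lam : HL_raising lam = HLfun lam.
Proof.
have sumn_nth s : \sum_(i < size s) nth 0%N s i = sumn s.
  by rewrite sumnE [RHS](big_nth 0%N) big_mkord.
elim: lam => [|m lam IH].
  rewrite /HL_raising /raising_sum /raising_term -big_mkcond (big_pred1 [ffun=> ord0]) => [|a].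
    by rewrite !big1 ?scale1r // => -[] // [].
  apply/forallP/eqP => [_|_ [[]] //]; by apply/ffunP => -[[]].
rewrite /HL_raising /= raising_sum_cons; last by rewrite (sumn_nth (m :: lam)).
rewrite -IH; congr (creation m _).
by apply: (@raising_sum_bound _ (fun i : 'I_(size lam) => nth 0%N lam i));
  rewrite ?sumn_nth ?leq_addl.
Qed.

Lemma HL_raising_sumE lam : HL_raising lam =
  \sum_(a : {ffun 'I_(size lam) * 'I_(size lam) -> 'I_(sumn lam).+1}
        | [forall ij : 'I_(size lam) * 'I_(size lam),
             (ij.2 <= ij.1)%N ==> (a ij == ord0)])
    (\prod_(ij : 'I_(size lam) * 'I_(size lam) | (ij.1 < ij.2)%N)
        raising_coef t (a ij)) *:
    \prod_(i < size lam)
      q_int ((nth 0%N lam i)%:Z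
            + \sum_(j < size lam | (i < j)%N) (a (i, j) : nat)%:Z
            - \sum_(j < size lam | (j < i)%N) (a (j, i) : nat)%:Z).
Proof.
rewrite /HL_raising /raising_sum /raising_term -big_mkcond; apply: eq_big => [a|a _].
  by apply: eq_forallb => ij; rewrite ffunE.
congr (_ *: _); first by apply: eq_bigr => ij _; rewrite ffunE.
apply: eq_bigr => i _; rewrite /raised_index.
by congr (q_int (_ + _ - _)); apply: eq_bigr => j _; rewrite ffunE.
Qed.

(** * Green polynomials *)

Section GreenPolynomials.
Variable X : seq nat -> seq nat -> K.
Hypothesis X_green : forall mu, is_partition mu ->
  pprod mu = \sum_(lam <- partitions (sumn mu))
    X lam mu *: ((bpart t lam)^-1 *: HL_raising lam).

Lemma bpart_HLnorm lam : is_partition lam -> bpart t lam = HLnorm lam.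
Proof.
elim: lam => [|n lam IH] pl; first by rewrite /bpart /HLnorm big_geq // big_ord0.
have [n0 _ pl'] := is_partition_cons pl.
rewrite HLnorm_cons -IH //.
apply: (prod_multiplicities_cons
  (f := fun _ c => \prod_(1 <= j < c.+1) (1 - t ^+ j))) => // [i|].
  by rewrite big_geq.
by rewrite big_nat_recr //= mulrC eqxx.
Qed.

Lemma HLnorm_neq0 lam : HLnorm lam != 0.
Proof.
rewrite prodf_seq_neq0; apply/allP => i _ /=.
by rewrite (drop_nth 0%N) //= eqxx.
Qed.

Lemma green_polynomialE lam mu n : is_partition_of n lam -> is_partition_of n mu ->
  X lam mu = green_form lam (pprod mu).
Proof.
move=> ln /andP[pm /eqP mn]; rewrite X_green // mn linear_sum /=.
have pl : is_partition lam by case/andP: ln.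
rewrite (bigD1_seq lam) ?partitions_uniq ?mem_partitions //=.
rewrite big1_seq ?addr0 => [|ka /andP[ne]]; last first.
  rewrite mem_partitions => /andP[pk _].
  by rewrite !linearZ /= HL_raisingE green_form_HLfun // eq_sym (negPf ne) !mulr0.
rewrite !linearZ /= HL_raisingE green_form_HLfun // eqxx bpart_HLnorm //.
by rewrite mulVf ?mulr1 // HLnorm_neq0.
Qed.

Theorem green_polynomial_formulas n lam : (1 <= n)%N -> is_partition_of n lam ->
  (forall k : nat, (k <= n - k)%N ->
     X (drop_zeros [:: n - k; k]%N) lam =
       \sum_(tau <- subpartitions lam | (sumn tau <= k)%N)
       \sum_(rho <- partitions (k - sumn tau))
         (-1) ^+ size rho / zpart_t t rho) /\
  (forall (mu : seq nat) (k : nat), is_partition_of n mu ->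
     (1 <= k <= n)%N ->
     X (k :: nseq (n - k) 1%N) mu =
       (\prod_(1 <= i < (n - k).+1) (t ^+ i - 1)) /
         (\prod_(j <- mu) (t ^+ j - 1)) *
       \sum_(tau <- subpartitions mu | (k <= sumn tau)%N)
         \prod_(j <- tau) (t ^+ j - 1)) /\
  (forall k1 k2 k3 : nat, (k3 <= k2 <= k1)%N -> (k1 + k2 + k3)%N = n ->
     X (drop_zeros [:: k1; k2; k3]) lam =
       \sum_(tau <- subpartitions lam | (sumn tau <= k2 + k3)%N)
       \sum_(rho <- partitions (k2 + k3 - sumn tau))
       \sum_(nu <- subpartitions (cup_partition tau rho) | (sumn nu <= k3)%N)
       \sum_(xi <- partitions (k3 - sumn nu))
         (-1) ^+ (size xi + size rho) / (zpart_t t xi * zpart_t t rho)) /\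
  (forall h1 h2 : nat, (1 <= h2 <= h1)%N -> (h1 + h2 <= n)%N ->
     X (h1 :: h2 :: nseq (n - h1 - h2) 1%N) lam =
       \sum_(tau <- subpartitions lam | (sumn tau <= n - h1)%N)
       \sum_(rho <- partitions (n - h1 - sumn tau))
       \sum_(mu <- subpartitions (cup_partition tau rho)
             | (h2 <= sumn mu <= n - h1)%N)
         (\prod_(1 <= i < (n - h1 - h2).+1) (t ^+ i - 1) *
          \prod_(l <- mu) (t ^+ l - 1)) /
         (zpart K rho * \prod_(j <- tau) (t ^+ j - 1))).
Proof.
move=> n1 ln; have [/andP[_ l0] /eqP sl] := andP ln.
have ones m : path geq 1 (nseq m 1%N) by elim: m.
have no0 m : 0%N \notin nseq m 1%N by rewrite mem_nseq andbF.
split=> [k kn|]; last split=> [mu k mn /andP[k1 kn]|];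
  last split=> [k1 k2 k3 /andP[k32 k21] kn|h1 h2 /andP[h2_1 h21] hn].
- have sk : sumn lam = (n - k + k)%N by lia.
  rewrite (green_polynomialE _ ln) ?green_form_two_rows //.
  have n0 : (0 < n - k)%N by lia.
  rewrite /drop_zeros /= n0; case: k {sk} kn n0 => [|k] kn n0.
    rewrite subn0; apply/andP; split; last by rewrite /= addn0.
    by rewrite /is_partition /= inE eq_sym -lt0n.
  rewrite /is_partition_of /is_partition /= !inE andbT.
  by apply/andP; split; [apply/andP; split|]; lia.
- have [/andP[_ m0] /eqP sm] := andP mn.
  rewrite (green_polynomialE _ mn); first by rewrite green_form_hook // sm subnKC.
  rewrite /is_partition_of /is_partition /= inE negb_or no0 sumn_nseq mul1n.
  rewrite subnKC // eqxx !andbT.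
  rewrite eq_sym -lt0n k1 andbT.
  by apply: (path_le geq_trans) (ones _); exact: k1.
- rewrite (green_polynomialE _ ln).
    by rewrite green_form_three_rows ?sl ?kn //; lia.
  have k1_0 : (0 < k1)%N by lia.
  rewrite /drop_zeros /= k1_0; case: k2 k32 k21 kn => [|k2] k32 k21 kn /=.
    have -> : k3 = 0%N by lia.
    rewrite /is_partition_of /is_partition /= inE; lia.
  case: k3 k32 kn => [|k3] k32 kn; rewrite /is_partition_of /is_partition /= !inE; lia.
rewrite (green_polynomialE _ ln).
  rewrite green_form_near_hook //; last by rewrite sl; lia.
  by have -> : (h2 + (n - h1 - h2) = n - h1)%N by lia.
rewrite /is_partition_of /is_partition /= !inE !negb_or no0 sumn_nseq mul1n h21 /=.
rewrite (path_le geq_trans (_ : geq h2 1%N)) ?ones //=.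
lia.
Qed.

End GreenPolynomials.

End VertexOperators.

(** * The letter morphisms and the field Q(t) *)

Section SymmetricFunctionRing.
Variables (K : fieldType) (t : K).
Hypothesis charK : forall n, n.+1%:R != 0 :> K.
Local Notation symfun := {malg K[{cmonom nat}]}.

Definition plus_letter : {rmorphism symfun -> {poly symfun}} :=
  subst_psum (polyC \o @malgC {cmonom nat} K) (fun n => (psum K n)%:P + 'X^n).

Definition minus_letter : {rmorphism symfun -> {poly symfun}} :=
  subst_psum (polyC \o @malgC {cmonom nat} K) (fun n => (psum K n)%:P - 'X^n).

Definition constant_term : {rmorphism symfun -> K} := subst_psum idfun (fun=> 0).

Lemma plus_letterA c : plus_letter c%:A = (c%:A)%:P.
Proof. by rewrite subst_psumZ rmorph1 mulr1 /= -mul_malgC mulr1. Qed.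

Lemma minus_letterA c : minus_letter c%:A = (c%:A)%:P.
Proof. by rewrite subst_psumZ rmorph1 mulr1 /= -mul_malgC mulr1. Qed.

Lemma constant_termA c : constant_term c%:A = c.
Proof. by rewrite subst_psumZ rmorph1 mulr1. Qed.

Lemma newton_qfun : newton (fun n => (1 - t ^+ n) *: psum K n : symfun) (qfun t).
Proof.
pose b n : symfun := ((1 - t ^+ n) / n%:R) *: psum K n.
apply: (@eq_newton _ (fun n => b n *+ n)); last exact: (@newton_exp_coef K symfun charK b).
case=> [|n]; first by rewrite mulr0n expr0 subrr scale0r.
by rewrite scalerMnl -mulr_natr mulfVK.
Qed.

Lemma HLQ_raisingE lam : HLQ t lam = HL_raising t (qfun t) lam.
Proof. by rewrite HL_raising_sumE. Qed.

End SymmetricFunctionRing.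

Lemma Qt_char0 n : n.+1%:R != 0 :> Qt.
Proof.
rewrite -(rmorph_nat (@FracField.tofrac {poly rat})) tofrac_eq0.
by rewrite -polyC_natr polyC_eq0 pnatr_eq0.
Qed.

Lemma Qt_t_not_root_of_unity i : 1 - t ^+ i.+1 != 0.
Proof.
rewrite /t -(rmorphXn (@FracField.tofrac {poly rat})).
rewrite -(rmorph1 (@FracField.tofrac {poly rat})).
rewrite -rmorphB tofrac_eq0 subr_eq0 eq_sym.
apply/negP => /eqP /(congr1 (fun P : {poly rat} => size P)).
by rewrite size_polyXn size_poly1.
Qed.

Theorem theorem2p10 (X : seq nat -> seq nat -> Qt) (HX : green_polynomials t X)
    (n : nat) (hn : (1 <= n)%N)
    (lam : seq nat) (hlam : is_partition_of n lam) :
  (forall k : nat, (k <= n - k)%N ->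
     X (drop_zeros [:: n - k; k]%N) lam =
       \sum_(tau <- subpartitions lam | (sumn tau <= k)%N)
       \sum_(rho <- partitions (k - sumn tau))
         (-1) ^+ size rho / zpart_t t rho) /\
  (forall (mu : seq nat) (k : nat), is_partition_of n mu ->
     (1 <= k <= n)%N ->
     X (k :: nseq (n - k) 1%N) mu =
       (\prod_(1 <= i < (n - k).+1) (t ^+ i - 1)) /
         (\prod_(j <- mu) (t ^+ j - 1)) *
       \sum_(tau <- subpartitions mu | (k <= sumn tau)%N)
         \prod_(j <- tau) (t ^+ j - 1)) /\
  (forall k1 k2 k3 : nat, (k3 <= k2 <= k1)%N -> (k1 + k2 + k3)%N = n ->
     X (drop_zeros [:: k1; k2; k3]) lam =
       \sum_(tau <- subpartitions lam | (sumn tau <= k2 + k3)%N)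
       \sum_(rho <- partitions (k2 + k3 - sumn tau))
       \sum_(nu <- subpartitions (cup_partition tau rho) | (sumn nu <= k3)%N)
       \sum_(xi <- partitions (k3 - sumn nu))
         (-1) ^+ (size xi + size rho) / (zpart_t t xi * zpart_t t rho)) /\
  (forall h1 h2 : nat, (1 <= h2 <= h1)%N -> (h1 + h2 <= n)%N ->
     X (h1 :: h2 :: nseq (n - h1 - h2) 1%N) lam =
       \sum_(tau <- subpartitions lam | (sumn tau <= n - h1)%N)
       \sum_(rho <- partitions (n - h1 - sumn tau))
       \sum_(mu <- subpartitions (cup_partition tau rho)
             | (h2 <= sumn mu <= n - h1)%N)
         (\prod_(1 <= i < (n - h1 - h2).+1) (t ^+ i - 1) *
          \prod_(l <- mu) (t ^+ l - 1)) /
         (zpart Qt rho * \prod_(j <- tau) (t ^+ j - 1))).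
Proof.
have X_green mu : is_partition mu -> pprod (psum Qt) mu =
    \sum_(ka <- partitions (sumn mu))
      X ka mu *: ((bpart t ka)^-1 *: HL_raising t (qfun t) ka).
  move=> pm; rewrite [LHS](HX mu pm).
  by apply: eq_bigr => ka _; rewrite /HLP HLQ_raisingE.
exact: (green_polynomial_formulas (sigma := plus_letter Qt) (tau := minus_letter Qt)
  (eps := constant_term Qt) Qt_char0 Qt_t_not_root_of_unity (@symfun_ind Qt)
  (@plus_letterA Qt) (@minus_letterA Qt) (@constant_termA Qt)
  (fun m => subst_psumE _ _ m) (fun m => subst_psumE _ _ m) (fun m => subst_psumE _ _ m)
  (newton_qfun t Qt_char0) X_green hn hlam).
Qed.
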